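(* For every odd integer $n\ge 3$ let $m_1(n),\dots,m_n(n)$ be real numbers such that $m_j(n)>0$ for every $1\le j\le n$ and such that the sequence is unimodal: there is $j^*=j^*(n)\in\{1,\dots,n\}$ with $m_1(n)\le \cdots\le m_{j^*}(n)\ge m_{j^*+1}(n)\ge\cdots\ge m_n(n)$. Let $z'=\sum_{j=1}^n m_j(n)$ and let $\Phi=\Phi_n$ be the Diaconis-Holmes-Neal sampler on $n$ states, with $\theta=1/n$ and underlying probabilities $\pi(j)=m_j(n)/z'$. Let $\tilde\pi$ be its stationary distribution, $\tilde\pi((\epsilon,j))=\pi(j)/2$, and let $P^z(y,\cdot)$ be the law of the chain after $z$ steps when started at the state $y$. Then for every constant $c>0$ there exist constants $\hat c>0$ and $C>0$, which do not depend on $n$ (but may depend on the family of underlying probabilities $\pi$ and on $c$), such that for every constant $c'>0$, every choice of integers $z=z(n)\ge c'n$ and every choice of initial states $y=y(n)$, $$\limsup_{n\to\infty,\ n\text{ odd}}\ \bigl\|P^{z}(y,\cdot)-\tilde\pi\bigr\|\ \le\ C\left(1-\frac{\hat c}{e^{c}}\right)^{\lfloor c'/c\rfloor}.$$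
   Context: Diaconis-Holmes-Neal sampler: given a probability distribution $\pi$ on $\{1,\dots,n\}$ with $\pi(j)>0$ for all $1\le j\le n$, and the convention $\pi(0)=\pi(n+1)=0$, and a parameter $0<\theta<1$ (here $\theta=1/n$), it is the Markov chain on the state space $\{+1,-1\}\times\{1,\dots,n\}$ in which one step from $(\epsilon,j)$ consists of the following two stages. (i) With probability $\alpha=\min\{1,\pi(j+\epsilon)/\pi(j)\}$ move to $(-\epsilon,j+\epsilon)$, and otherwise remain at $(\epsilon,j)$. (ii) Then, with probability $1-\theta$ (independently), change the sign of the first coordinate, and otherwise leave it unchanged. Equivalently, from $(\epsilon,j)$ one step leads to $(\epsilon,j+\epsilon)$ with probability $(1-\theta)\alpha$ (a shift), to $(-\epsilon,j)$ with probability $(1-\theta)(1-\alpha)$ (a jump), to $(-\epsilon,j+\epsilon)$ with probability $\theta\alpha$ (a flip), and to $(\epsilon,j)$ with probability $\theta(1-\alpha)$ (a stationary move). Variation distance: for probabilities $P,Q$ on a finite set $S$, $\|P-Q\|=\frac12\sum_{s\in S}|P(s)-Q(s)|$. *)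

(* Defs.v *)
From HB Require Import structures.
From mathcomp Require Import all_boot all_order all_algebra.
From mathcomp Require Import all_classical all_reals all_analysis.

Set Implicit Arguments.
Unset Strict Implicit.
Unset Printing Implicit Defensive.

Import Order.TTheory GRing.Theory Num.Theory.
Local Open Scope ring_scope.

Definition tv_dist (R : realType) (S : finType) (P Q : S -> R) : R :=
  2^-1 * \sum_(s : S) `|P s - Q s|.

(* A transition kernel [K] on a finite type gives in [K x y] the probability
   of going from [x] to [y]. *)
Definition kernel_id (R : realType) (S : finType) (x y : S) : R := (x == y)%:R.

Definition kernel_comp (R : realType) (S : finType) (K L : S -> S -> R) (x y : S) : R :=
  \sum_(s : S) K x s * L s y.

Definition kernel_pow (R : realType) (S : finType) (K : S -> S -> R) (z : nat) :
    S -> S -> R :=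
  iter z (kernel_comp K) (@kernel_id R S).

(* The state (epsilon, j) of {+1,-1} x {1,...,n}; [true] stands for
   epsilon = +1, and [i : 'I_n] (which ranges over 0,...,n-1) stands for
   j = i + 1. *)
Definition state (n : nat) : finType := (bool * 'I_n)%type.

Definition eps_of (n : nat) (x : state n) : int := if x.1 then 1 else -1.

Definition label (n : nat) (i : 'I_n) : int := i.+1%:Z.

(* [p] as a function of labels, extended by 0 outside {1,...,n}; the sum has
   at most one term. *)
Definition extend0 (R : realType) (n : nat) (p : 'I_n -> R) (j : int) : R :=
  \sum_(i < n | label i == j) p i.

Definition accept_prob (R : realType) (n : nat) (p : 'I_n -> R) (x : state n) : R :=
  Num.min 1 (extend0 p (label x.2 + eps_of x) / p x.2).

(* When j + epsilon is outside {1,...,n}, no state [y] satisfies the first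
   condition, and [accept_prob p x = 0]. *)
Definition dhn_move (R : realType) (n : nat) (p : 'I_n -> R) (x y : state n) : R :=
  accept_prob p x
    * ((y.1 == ~~ x.1) && (label y.2 == label x.2 + eps_of x))%:R
  + (1 - accept_prob p x) * (y == x)%:R.

Definition dhn_sign (R : realType) (n : nat) (theta : R) (x y : state n) : R :=
  (1 - theta) * (y == (~~ x.1, x.2))%:R + theta * (y == x)%:R.

Definition dhn_sampler (R : realType) (n : nat) (theta : R) (p : 'I_n -> R) :
    state n -> state n -> R :=
  kernel_comp (dhn_move p) (dhn_sign theta).

Definition dhn_stationary (R : realType) (n : nat) (p : 'I_n -> R) (x : state n) : R :=
  p x.2 / 2.

Definition normalize (R : realType) (n : nat) (m : 'I_n -> R) (j : 'I_n) : R :=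
  m j / \sum_(i < n) m i.

Definition unimodal (R : realType) (n : nat) (m : 'I_n -> R) : Prop :=
  exists jstar : 'I_n,
    (forall i j : 'I_n, (i <= j)%N -> (j <= jstar)%N -> m i <= m j) /\
    (forall i j : 'I_n, (jstar <= i)%N -> (i <= j)%N -> m j <= m i).

(* The odd integers n >= 3 are 3, 5, 7, ... in increasing order, so that a
   limit superior over odd n tending to infinity is one over k of the
   quantity at [n = odd_ge3 k]. *)
Definition odd_ge3 (k : nat) : nat := k.*2.+3.

(* Main.v *)
Require Import Defs.
From HB Require Import structures.
From mathcomp Require Import all_boot all_order all_algebra.
From mathcomp Require Import all_classical all_reals all_analysis.
From mathcomp Require Import ring lra zify.

(** Fix [n], put [theta = 1/n] and let [j] be a mode of [p].  A step of the
chain is [P = M B], where [M] (move or stay) and [B] (change sign with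
probability [1 - theta]) are both self-adjoint for the stationary law [target].
With [S] the change of direction, [K = M S] is the chain conditioned never to
flip, and [P = (1 - theta) K + theta K S].  The number of flips in [a n] steps is
roughly Poisson, so that every pattern of boundedly many flips has a
probability bounded below.  All constants are uniform in [n] and in the
unimodal [p]; four facts produce them.

- Occupation ([occupation_noflip_ge], [occupation_noflip_le]).  Uphill moves of
  [K] are certain, so within [2 n] steps [K] visits the mode in any prescribed
  direction.  Since the reversal of [K] is [S K S], this bounds the expected
  time spent in [s] before time [M], starting at the mode, between multiples of
  [target s], and from below for any start: on average over [O(n)] steps, [K]
  is mixed.

- Mean-square contraction ([msq_even_drift], [sampler_msq_contract]).  Flips
  turn this average into a statement at fixed times.  A function almost fixed by
  [B] at most times satisfies [P^(2r) f ~ B P^(2r) f = P*^r B P^r f ~ P*^r P^r f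
  ~ f]; so a function losing little mean square in [8 n] steps is almost equal
  to the average of its even iterates, while by the occupation bound averaging
  brings it closer to being constant on each of the two parity classes.  The
  remaining function, the parity itself, is multiplied by [- (1 - 2 theta)] at
  each step.

- Warm start ([return_law_le], [return_law_mass]).  Mean-square contraction
  says nothing about a start at a point, whose density is unbounded.  Consider
  trajectories flipping exactly once, while moving away from the mode: they are
  carried back to the mode, and by [passage_le1] their time of arrival has, up
  to the factor [theta], weights at most 1.  From there the occupation bounds
  apply, giving a part of the law at time [7 n] with mass bounded below and
  density bounded above.

- Hence from every start the law after [O(n)] steps dominates, against
  functions with values in [[0, c]], a fixed multiple of [target] up to a small
  error ([sampler_minorization]), so the oscillation of functions contracts
  ([osc_contract], [sampler_tv_dist]).

This gives a rate [r < 1] per [A n] steps; [rescale_rate] converts it to a rate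
[s < 1] per [c n] steps, and [chat = (1 - s) e^c]. *)

Set Implicit Arguments.
Unset Strict Implicit.
Unset Printing Implicit Defensive.

Import Order.TTheory GRing.Theory Num.Theory.
Local Open Scope ring_scope.

(** * Kernels acting on functions *)

Section Kernels.
Variables (R : realType) (S : finType).
Implicit Types (k l : S -> S -> R) (f g : S -> R) (x y s : S).

Definition kernel_op k f x : R := \sum_y k x y * f y.

Definition stochastic k : Prop :=
  (forall x y, 0 <= k x y) /\ (forall x, \sum_y k x y = 1).

Lemma kernel_op_comp k l f :
  kernel_op (kernel_comp k l) f = kernel_op k (kernel_op l f).
Proof.
apply: funext => x; rewrite /kernel_op /kernel_comp.
under eq_bigr => y _ do rewrite mulr_suml.
rewrite exchange_big; apply: eq_bigr => y _ /=.
by rewrite mulr_sumr; apply: eq_bigr => s _; rewrite mulrA.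
Qed.

Lemma kernel_op_id f : kernel_op (@kernel_id R S) f = f.
Proof.
apply: funext => x; rewrite /kernel_op /kernel_id (bigD1 x) //= eqxx mul1r.
by rewrite big1 ?addr0 // => y /negPf yx; rewrite eq_sym yx mul0r.
Qed.

Lemma kernel_op_pow k z f : kernel_op (kernel_pow k z) f = iter z (kernel_op k) f.
Proof.
elim: z => [|z IHz] /=; first exact: kernel_op_id.
by rewrite kernel_op_comp -/(kernel_pow k z) IHz.
Qed.

Lemma kernel_powS k t x s :
  kernel_pow k t.+1 x s = kernel_op k (kernel_pow k t ^~ s) x.
Proof. by []. Qed.

Lemma kernel_powD k a b x s :
  kernel_pow k (a + b) x s = \sum_w kernel_pow k a x w * kernel_pow k b w s.
Proof.
rewrite -[RHS]/(kernel_op _ (kernel_pow k b ^~ s) x) kernel_op_pow.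
by elim: a x => [|a IHa] x //=; apply: eq_bigr => y _; rewrite -IHa.
Qed.

Lemma kernel_powSr k t x s :
  kernel_pow k t.+1 x s = \sum_w kernel_pow k t x w * k w s.
Proof.
rewrite -addn1 kernel_powD; apply: eq_bigr => w _; congr (_ * _).
rewrite kernel_powS /kernel_op (bigD1 s) //= /kernel_id eqxx mulr1.
by rewrite big1 ?addr0 // => y /negPf ys; rewrite ys mulr0.
Qed.

Lemma kernel_pow1 k x s : kernel_pow k 1 x s = k x s.
Proof.
rewrite kernel_powSr (bigD1 x) //= /kernel_id eqxx mul1r.
by rewrite big1 ?addr0 // => y /negPf yx; rewrite eq_sym yx mul0r.
Qed.

Lemma stochastic_op1 k c : stochastic k -> kernel_op k (fun=> c) = fun=> c.
Proof.
by move=> [_ k1]; apply: funext => x; rewrite /kernel_op -mulr_suml k1 mul1r.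
Qed.

Lemma ler_kernel_op k f g x : (forall y, 0 <= k x y) ->
  (forall y, f y <= g y) -> kernel_op k f x <= kernel_op k g x.
Proof. by move=> k0 fg; apply: ler_sum => y _; rewrite ler_wpM2l. Qed.

Lemma kernel_opB k f g : kernel_op k (f - g) = kernel_op k f - kernel_op k g.
Proof.
apply: funext => x; rewrite !fctE /kernel_op -sumrB.
by apply: eq_bigr => y _; rewrite mulrBr.
Qed.

Lemma kernel_op_sum k (I : finType) (A : pred I) (F : I -> S -> R) x :
  kernel_op k (fun y => \sum_(i | A i) F i y) x = \sum_(i | A i) kernel_op k (F i) x.
Proof.
rewrite /kernel_op exchange_big; apply: eq_bigr => y _.
by rewrite mulr_sumr.
Qed.

Lemma kernel_opZ k c f : kernel_op k (fun y => c * f y) = fun x => c * kernel_op k f x.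
Proof.
by apply: funext => x; rewrite /kernel_op mulr_sumr; apply: eq_bigr => y _; rewrite mulrCA.
Qed.

Lemma stochastic_comp k l :
  stochastic k -> stochastic l -> stochastic (kernel_comp k l).
Proof.
move=> [k0 k1] [l0 l1]; split => [x y|x].
  by apply: sumr_ge0 => s _; rewrite mulr_ge0.
rewrite exchange_big /= -[RHS](k1 x); apply: eq_bigr => y _.
by rewrite -mulr_sumr l1 mulr1.
Qed.

Lemma stochastic_id : stochastic (@kernel_id R S).
Proof.
split => [x y|x]; first exact: ler0n.
rewrite (bigD1 x) //= /kernel_id eqxx big1 ?addr0 // => y /negPf yx.
by rewrite eq_sym yx.
Qed.

Lemma stochastic_pow k z : stochastic k -> stochastic (kernel_pow k z).
Proof.
move=> hk; elim: z => [|z IHz]; first exact: stochastic_id.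
exact: stochastic_comp.
Qed.

Definition stationary (pi : S -> R) k : Prop :=
  forall y, \sum_x pi x * k x y = pi y.

Lemma stationary_comp pi k l :
  stationary pi k -> stationary pi l -> stationary pi (kernel_comp k l).
Proof.
move=> pik pil y; rewrite -[RHS]pil.
under eq_bigr => x _ do rewrite mulr_sumr.
rewrite exchange_big; apply: eq_bigr => w _ /=.
by rewrite -pik mulr_suml; apply: eq_bigr => x _; rewrite mulrA.
Qed.

Lemma stationary_pow pi k z : stationary pi k -> stationary pi (kernel_pow k z).
Proof.
move=> pik; elim: z => [|z IHz]; last exact: stationary_comp.
move=> y; rewrite (bigD1 y) //= /kernel_id eqxx mulr1 big1 ?addr0 // => x /negPf xy.
by rewrite xy mulr0.
Qed.

End Kernels.

(** * Occupation times of a chain that must pass through a given state *)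

Section Occupation.
Variables (R : realType) (S : finType) (k : S -> S -> R).
Hypothesis k_stoch : stochastic k.

Definition occupation (M : nat) (x s : S) : R := \sum_(t < M) kernel_pow k t x s.

Let k0 x y : 0 <= k x y. Proof. exact: k_stoch.1. Qed.
Let kp0 t x y : 0 <= kernel_pow k t x y.
Proof. exact: (stochastic_pow t k_stoch).1. Qed.

Lemma occupationS M x s :
  occupation M.+1 x s = kernel_id R x s + kernel_op k (occupation M ^~ s) x.
Proof.
rewrite /occupation big_ord_recl; congr (_ + _).
by rewrite kernel_op_sum.
Qed.

Lemma occupation_mono M N x s : (M <= N)%N -> occupation M x s <= occupation N x s.
Proof.
move=> MN; rewrite /occupation -(big_mkord xpredT (fun t => kernel_pow k t x s)).
rewrite -(big_mkord xpredT (fun t => kernel_pow k t x s)).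
rewrite (big_cat_nat (leq0n M) MN) /= lerDl sumr_ge0 //.
Qed.

(** Nothing is counted before the first visit to [o]. *)
Lemma occupation_max M x o : occupation M x o <= occupation M o o.
Proof.
elim: M x => [|M IHM] x; first by rewrite /occupation !big_ord0.
have [->//|xo] := eqVneq x o.
rewrite occupationS /kernel_id (negPf xo) add0r.
apply: le_trans (occupation_mono _ _ (leqnSn M)).
rewrite -[leRHS](congr1 (@^~ x) (stochastic_op1 (occupation M o o) k_stoch)).
exact: ler_kernel_op.
Qed.

Variables (o : S) (rank : S -> nat).
Hypothesis rank_lt : forall x y, x != o -> k x y != 0 -> (rank y < rank x)%N.

(** The rank strictly decreases until [o] is met, so [o] is met within
[rank x] steps. *)
Lemma occupation_hit M x s : occupation M o s <= occupation (M + rank x) x s.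
Proof.
have [d] := ubnP (rank x); elim: d x => // d IHd x xd.
have [->|xo] := eqVneq x o; first exact: occupation_mono (leq_addr _ _).
have rank0 : (0 < rank x)%N.
  have [y yP] : exists y, k x y != 0.
    apply/existsP; apply: contraT; rewrite negb_exists => /forallP kx.
    have := k_stoch.2 x; rewrite big1 => [/eqP|y _]; last exact/eqP/negPn.
    by rewrite eq_sym oner_eq0.
  exact: leq_trans (rank_lt xo yP).
rewrite -(prednK rank0) addnS occupationS.
rewrite -[leLHS](congr1 (@^~ x) (stochastic_op1 (occupation M o s) k_stoch)).
rewrite ler_wpDl ?ler0n //; apply: ler_sum => y _.
have [->|kxy] := eqVneq (k x y) 0; first by rewrite !mul0r.
rewrite ler_wpM2l //; apply: (le_trans (IHd y _)).
  exact: leq_trans (rank_lt xo kxy) _.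
apply: occupation_mono; rewrite leq_add2l -ltnS prednK //.
exact: rank_lt.
Qed.

Variables (pi : S -> R) (d : nat).
Hypothesis pi_ge0 : forall x, 0 <= pi x.
Hypothesis pi_sum : \sum_x pi x = 1.
Hypothesis pi_inv : stationary pi k.
Hypothesis rank_le : forall x, (rank x <= d)%N.

Lemma occupation_avg M s : \sum_x pi x * occupation M x s = M%:R * pi s.
Proof.
under eq_bigr => x _ do rewrite mulr_sumr.
rewrite exchange_big /= -[M in RHS]card_ord -sumr_const mulr_suml.
by apply: eq_bigr => t _; rewrite mul1r stationary_pow.
Qed.

Lemma occupation_ge M : M%:R * pi o <= occupation M o o.
Proof.
rewrite -occupation_avg -[leRHS]mul1r -pi_sum mulr_suml.
by apply: ler_sum => x _; rewrite ler_wpM2l // occupation_max.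
Qed.

Lemma occupation_le M : occupation M o o <= (M + d)%:R * pi o.
Proof.
rewrite -occupation_avg -[leLHS]mul1r -pi_sum mulr_suml.
apply: ler_sum => x _; rewrite ler_wpM2l // (le_trans (occupation_hit M x o)) //.
by apply: occupation_mono; rewrite leq_add2l.
Qed.

End Occupation.

(** A chain whose time reversal is its conjugate by an involution [sig], with a
state [o] met at a bounded time from everywhere, and so is [sig o]. *)
Section SkewReversible.
Variables (R : realType) (S : finType) (k : S -> S -> R) (pi : S -> R).
Variables (sig : S -> S) (o : S) (rank rank' : S -> nat) (d : nat).
Hypothesis k_stoch : stochastic k.
Hypothesis pi_gt0 : forall x, 0 < pi x.
Hypothesis pi_sum : \sum_x pi x = 1.
Hypothesis pi_inv : stationary pi k.
Hypothesis sigK : involutive sig.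
Hypothesis pi_sig : forall x, pi (sig x) = pi x.
Hypothesis k_skew : forall x y, pi x * k x y = pi y * k (sig y) (sig x).
Hypothesis rank_lt : forall x y, x != o -> k x y != 0 -> (rank y < rank x)%N.
Hypothesis rank_le : forall x, (rank x <= d)%N.
Hypothesis rank'_lt :
  forall x y, x != sig o -> k x y != 0 -> (rank' y < rank' x)%N.
Hypothesis rank'_le : forall x, (rank' x <= d)%N.

Lemma kernel_pow_skew t x y :
  pi x * kernel_pow k t x y = pi y * kernel_pow k t (sig y) (sig x).
Proof.
elim: t x y => [|t IHt] x y.
  rewrite /= /kernel_id (inj_eq (inv_inj sigK)) eq_sym.
  by case: eqVneq => [->|]; rewrite ?mulr0.
rewrite kernel_powS /kernel_op mulr_sumr kernel_powSr mulr_sumr.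
rewrite (reindex_inj (inv_inj sigK)); apply: eq_bigr => w _ /=.
by rewrite mulrA k_skew sigK mulrAC IHt sigK mulrA.
Qed.

Lemma occupation_skew M x y :
  pi x * occupation k M x y = pi y * occupation k M (sig y) (sig x).
Proof.
by rewrite !mulr_sumr; apply: eq_bigr => t _; apply: kernel_pow_skew.
Qed.

(** Wait for [o]; the occupation of [s] starting at [o] is, read backwards, an
occupation of [sig o] starting at [sig s], so wait for [sig o] as well. *)
Lemma occupation_lower M x s : M%:R * pi s <= occupation k (M + d + d) x s.
Proof.
have pi_ge0 y : 0 <= pi y by exact: ltW.
apply: (@le_trans _ _ (occupation k (M + d) o s)); last first.
  apply: le_trans (occupation_hit k_stoch rank_lt _ x s) _.
  by apply: occupation_mono => //; rewrite leq_add2l.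
rewrite -(ler_pM2l (pi_gt0 o)) occupation_skew mulrCA [pi o * _]mulrC mulrCA.
rewrite ler_pM2l // -[pi o]pi_sig.
apply: (le_trans (occupation_ge k_stoch (sig o) pi_ge0 pi_sum pi_inv M)).
apply: le_trans (occupation_hit k_stoch rank'_lt _ (sig s) _) _.
by apply: occupation_mono => //; rewrite leq_add2l.
Qed.

Lemma occupation_upper M s : occupation k M o s <= (M + d)%:R * pi s.
Proof.
have pi_ge0 y : 0 <= pi y by exact: ltW.
rewrite -(ler_pM2l (pi_gt0 o)) occupation_skew mulrCA [pi o * _]mulrC mulrCA.
rewrite ler_pM2l // -[pi o]pi_sig; apply: le_trans (occupation_max _ _ _ _) _ => //.
exact: (occupation_le k_stoch rank'_lt pi_ge0 pi_sum pi_inv).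
Qed.

End SkewReversible.

(** * Mean-square contraction *)

Lemma weighted_jensen (R : realType) (I : finType) (w f : I -> R) (c : R) :
  (forall i, 0 <= w i) -> 0 < c -> \sum_i w i <= c ->
  (\sum_i w i * f i) ^+ 2 <= c * \sum_i w i * f i ^+ 2.
Proof.
move=> w0 c0 wc; set u := \sum_i w i * f i; pose a := u / c.
have ac : a * c = u by rewrite /a divfK ?gt_eqF.
have : 0 <= \sum_i w i * (f i - a) ^+ 2.
  by apply: sumr_ge0 => i _; rewrite mulr_ge0 ?sqr_ge0.
have -> : \sum_i w i * (f i - a) ^+ 2 =
    \sum_i w i * f i ^+ 2 - 2 * a * u + a ^+ 2 * \sum_i w i.
  rewrite /u !mulr_sumr -sumrB -big_split; apply: eq_bigr => i _ /=.
  by rewrite !expr2; ring.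
rewrite -ac => h.
have : 0 <= \sum_i w i * f i ^+ 2 - a ^+ 2 * c.
  apply: le_trans h _.
  have := ler_wpM2l (sqr_ge0 a) wc; rewrite !expr2; lra.
by move/(mulr_ge0 (ltW c0)); rewrite !expr2; lra.
Qed.

Section MeanSquare.
Variables (R : realType) (S : finType) (pi : S -> R).
Hypothesis pi_ge0 : forall x, 0 <= pi x.
Implicit Types (f g : S -> R) (k : S -> S -> R).

Definition inner f g : R := \sum_x pi x * (f x * g x).
Definition msq f : R := \sum_x pi x * f x ^+ 2.

Lemma msq_ge0 f : 0 <= msq f.
Proof. by apply: sumr_ge0 => x _; rewrite mulr_ge0 ?sqr_ge0. Qed.

Lemma msqE f : msq f = inner f f.
Proof. by []. Qed.

Lemma msqN f : msq (- f) = msq f.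
Proof. by apply: eq_bigr => x _; rewrite fctE sqrrN. Qed.

Lemma msqB f g : msq (f - g) = msq f - 2 * inner f g + msq g.
Proof.
rewrite /msq /inner mulr_sumr -sumrB -big_split; apply: eq_bigr => x _ /=.
by rewrite !fctE !expr2; ring.
Qed.

Lemma msqD3 f g h : msq (f + g + h) <= 3 * (msq f + msq g + msq h).
Proof.
rewrite /msq -!big_split mulr_sumr; apply: ler_sum => x _ /=; rewrite !fctE.
rewrite -!mulrDr [leRHS]mulrCA ler_wpM2l // -subr_ge0.
have -> : 3 * (f x ^+ 2 + g x ^+ 2 + h x ^+ 2) - (f x + g x + h x) ^+ 2 =
  (f x - g x) ^+ 2 + (g x - h x) ^+ 2 + (f x - h x) ^+ 2 by ring.
by rewrite !addr_ge0 ?sqr_ge0.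
Qed.

Lemma msq_kernel_op k a b f : (forall x y, 0 <= k x y) -> 0 < a ->
  (forall x, \sum_y k x y <= a) ->
  (forall y, \sum_x pi x * k x y <= b * pi y) ->
  msq (kernel_op k f) <= a * b * msq f.
Proof.
move=> k0 a0 ka kb.
apply: (@le_trans _ _ (\sum_x pi x * (a * \sum_y k x y * f y ^+ 2))).
  by apply: ler_sum => x _; rewrite ler_wpM2l // weighted_jensen.
have -> : \sum_x pi x * (a * \sum_y k x y * f y ^+ 2) =
    \sum_y a * f y ^+ 2 * \sum_x pi x * k x y.
  under eq_bigr => x _ do rewrite !mulr_sumr.
  rewrite exchange_big; apply: eq_bigr => y _ /=; rewrite mulr_sumr.
  by apply: eq_bigr => x _; rewrite !expr2; ring.
rewrite /msq mulr_sumr; apply: ler_sum => y _.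
have -> : a * b * (pi y * f y ^+ 2) = a * f y ^+ 2 * (b * pi y) by ring.
by apply: ler_wpM2l => //; rewrite mulr_ge0 ?sqr_ge0 // ltW.
Qed.

Definition reversible k := forall x y, pi x * k x y = pi y * k y x.

Lemma reversible_inner k f g : reversible k ->
  inner f (kernel_op k g) = inner (kernel_op k f) g.
Proof.
move=> hk; rewrite /inner.
under eq_bigr => x _ do rewrite !mulr_sumr.
under [RHS]eq_bigr => x _ do rewrite mulr_suml mulr_sumr.
rewrite exchange_big; apply: eq_bigr => y _; apply: eq_bigr => x _ /=.
have e : pi x * (f x * (k x y * g y)) = (pi x * k x y) * f x * g y by ring.
by rewrite e hk; ring.
Qed.

Lemma reversible_stationary k : reversible k -> stochastic k -> stationary pi k.
Proof.
move=> hk [_ k1] y; rewrite -[RHS]mulr1 -(k1 y) mulr_sumr.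
exact: eq_bigr.
Qed.

Lemma msq_reversible k f :
  reversible k -> stochastic k -> msq (kernel_op k f) <= msq f.
Proof.
move=> hk sk; rewrite -[leRHS]mul1r -[1 in leRHS]mul1r.
apply: msq_kernel_op => //; first exact: sk.1.
  by move=> x; rewrite sk.2.
by move=> y; rewrite reversible_stationary // mul1r.
Qed.

(** For [P = M B] with [M] and [B] self-adjoint, [P^* = B M] and
[B P^r = P^*^r B].  Write [f_t = P^t f].  If little mean square is lost over
[2 N] steps, then [f_t] is almost fixed by [B] for most [t], and [P^*^r P^r f]
almost equals [f]; so [f_{2r}], [B f_{2r} = P^*^r B f_r], [P^*^r f_r] and [f] are
all close: the even iterates hardly move.  The point of this chain of
approximations is that its error does not grow with [r]. *)
Section TwoReflections.
Variables (m b : S -> S -> R) (theta : R).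
Hypotheses (m_rev : reversible m) (m_stoch : stochastic m).
Hypotheses (b_rev : reversible b) (b_stoch : stochastic b).
Hypothesis theta_gt0 : 0 < theta.
Hypothesis b_loss : forall f,
  theta * msq (f - kernel_op b f) <= msq f - msq (kernel_op b f).

Let P := kernel_op (kernel_comp m b).
Let P' := kernel_op (kernel_comp b m).

Let PE f : P f = kernel_op m (kernel_op b f).
Proof. exact: kernel_op_comp. Qed.
Let P'E f : P' f = kernel_op b (kernel_op m f).
Proof. exact: kernel_op_comp. Qed.

Let P_le f : msq (P f) <= msq f.
Proof. by rewrite PE (le_trans (msq_reversible _ m_rev _)) // msq_reversible. Qed.
Let P'_le f : msq (P' f) <= msq f.
Proof. by rewrite P'E (le_trans (msq_reversible _ b_rev _)) // msq_reversible. Qed.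

Lemma msq_iter_le t f : msq (iter t P f) <= msq f.
Proof. by elim: t => //= t IHt; apply: le_trans (P_le _) IHt. Qed.

Let P'_iter_le t f : msq (iter t P' f) <= msq f.
Proof. by elim: t => //= t IHt; apply: le_trans (P'_le _) IHt. Qed.

Let iterB t f g : iter t P' (f - g) = iter t P' f - iter t P' g.
Proof. by elim: t => //= t ->; apply: kernel_opB. Qed.

Let b_iter r f : kernel_op b (iter r P f) = iter r P' (kernel_op b f).
Proof.
elim: r f => // r IHr f; rewrite iterSr IHr iterSr; congr (iter _ _ _).
by rewrite PE P'E.
Qed.

Let P_adj r f g : inner f (iter r P g) = inner (iter r P' f) g.
Proof.
elim: r f => // r IHr f.
by rewrite [in RHS]iterSr iterS -IHr PE reversible_inner // reversible_inner // P'E.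
Qed.

(** [P'^r P^r] is a positive contraction, within the lost mean square of the
identity. *)
Let msq_return r f :
  msq (iter r P' (iter r P f) - f) <= msq f - msq (iter r P f).
Proof.
rewrite msqB -P_adj -msqE; have := P'_iter_le r (iter r P f); lra.
Qed.

Let step_loss f : theta * msq (f - kernel_op b f) <= msq f - msq (P f).
Proof.
apply: le_trans (b_loss f) _; rewrite lerD2l lerN2 PE.
exact: msq_reversible.
Qed.

Lemma msq_even_drift r f :
  msq (iter r.*2 P f - f) <=
  3 * (msq (iter r.*2 P f - kernel_op b (iter r.*2 P f))
       + msq (iter r P f - kernel_op b (iter r P f))
       + (msq f - msq (iter r P f))).
Proof.
set g := iter r P f; set h := iter _ P f.
have hE : kernel_op b h = iter r P' (kernel_op b g).
  by rewrite /h -addnn iterD b_iter.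
have -> : h - f = (h - kernel_op b h) + iter r P' (kernel_op b g - g)
                  + (iter r P' g - f).
  by rewrite iterB -hE !subrKA.
apply: le_trans (msqD3 _ _ _) _; rewrite ler_pM2l // lerD ?msq_return //.
by rewrite lerD2l (le_trans (P'_iter_le _ _)) // -msqN opprB.
Qed.

Lemma sum_msq_even_drift N f :
  \sum_(r < N) msq (iter r.*2 P f - f) <=
  3 * (2 / theta + N%:R) * (msq f - msq (iter N.*2 P f)).
Proof.
set E := _ - _; pose d t := msq (iter t P f - kernel_op b (iter t P f)).
have dle t : d t <= (msq (iter t P f) - msq (iter t.+1 P f)) / theta.
  by rewrite ler_pdivlMr // mulrC step_loss.
have mono t u : (t <= u)%N -> msq (iter u P f) <= msq (iter t P f).
  by move=> tu; rewrite -(subnK tu) iterD msq_iter_le.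
have sumd : \sum_(r < N) d r <= E / theta.
  apply: (@le_trans _ _ ((msq f - msq (iter N P f)) / theta)).
    elim: N {E} => [|N IHN]; first by rewrite big_ord0 subrr mul0r.
    rewrite big_ord_recr /=; have := dle N; move: IHN.
    rewrite !mulrBl /=; lra.
  rewrite ler_pM2r ?invr_gt0 // lerD2l lerN2 mono //; lia.
have sumd2 : \sum_(r < N) d r.*2 <= E / theta.
  rewrite /E; elim: N {E sumd} => [|N IHN]; first by rewrite big_ord0 subrr mul0r.
  rewrite big_ord_recr /=; have := dle N.*2; move: IHN.
  have : msq (iter N.+1.*2 P f) / theta <= msq (iter N.*2.+1 P f) / theta.
    by rewrite ler_pM2r ?invr_gt0 // mono.
  rewrite !mulrBl doubleS /=; lra.
apply: (@le_trans _ _ (\sum_(r < N) 3 * (d r.*2 + d r + E))).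
  apply: ler_sum => r _; apply: le_trans (msq_even_drift r f) _.
  rewrite ler_pM2l // lerD2l /E lerD2l lerN2 mono //.
  by have := ltn_ord r; lia.
rewrite -mulr_sumr big_split big_split /= sumr_const card_ord -[_ *+ N]mulr_natl.
by rewrite -mulrA ler_pM2l // mulrDl lerD2r mulrAC -mulrA mulr2n mulrDl mul1r lerD.
Qed.

Variable chi : S -> R.
Hypotheses (pi_sum : \sum_x pi x = 1) (chi_sum : \sum_x pi x * chi x = 0).
(** The orthogonal projection on the span of the constants and of [chi], for a
centred [chi] of mean square 1. *)
Definition two_class_kernel x s : R := pi s * (1 + chi x * chi s).

Variables (delta : R) (N : nat).
Hypotheses (delta_gt0 : 0 < delta) (delta_lt1 : delta < 1).
Hypothesis N_large : 4 / theta <= N%:R.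
Hypothesis avg_ge : forall x s,
  delta * two_class_kernel x s <=
  N%:R^-1 * \sum_(r < N) kernel_pow (kernel_comp m b) r.*2 x s.

(** The average [A] of the even iterates contains [delta] times a projection
that kills [f], so [|A f| <= (1 - delta) |f|]; but [f - A f] is controlled by the
lost mean square, which therefore cannot be small. *)
Lemma msq_contract_orth f :
  \sum_x pi x * f x = 0 -> \sum_x pi x * (chi x * f x) = 0 ->
  msq (iter N.*2 P f) <= (1 - delta ^+ 2 / 10) * msq f.
Proof.
move=> f1 fchi; set E := msq f - msq (iter N.*2 P f).
have N0 : 0 < N%:R :> R by apply: lt_le_trans N_large; rewrite divr_gt0.
pose A x s := N%:R^-1 * \sum_(r < N) kernel_pow (kernel_comp m b) r.*2 x s.
have AE : kernel_op A f = fun x => N%:R^-1 * \sum_(r < N) iter r.*2 P f x.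
  apply: funext => x; rewrite /kernel_op /A.
  under eq_bigr => y _ do rewrite -mulrA mulr_suml.
  rewrite -mulr_sumr; congr (_ * _).
  by rewrite exchange_big; apply: eq_bigr => r _; rewrite -kernel_op_pow.
have mb_stoch := stochastic_comp m_stoch b_stoch.
have mb_inv : stationary pi (kernel_comp m b).
  by apply: stationary_comp; exact: reversible_stationary.
have near : msq (f - kernel_op A f) <= 5 * E.
  have -> : f - kernel_op A f =
      fun x => \sum_(r < N) N%:R^-1 * (f - iter r.*2 P f) x.
    apply: funext => x; rewrite AE !fctE -mulr_sumr sumrB sumr_const card_ord.
    by rewrite mulrBr -[f x *+ N]mulr_natl mulKf ?gt_eqF.
  apply: (@le_trans _ _ (N%:R^-1 * \sum_(r < N) msq (iter r.*2 P f - f))).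
    rewrite [\sum_(r < N) _]exchange_big mulr_sumr; apply: ler_sum => x _ /=.
    rewrite -[X in _ <= _ * X]mulr_sumr [leRHS]mulrCA ler_wpM2l //.
    apply: le_trans (weighted_jensen _ _ ltr01 _) _ => [r||].
    - by rewrite invr_ge0 ltW.
    - by rewrite sumr_const card_ord -[_ *+ N]mulr_natl divff ?gt_eqF.
    rewrite mul1r mulr_sumr; apply: ler_sum => r _.
    by rewrite -opprB fctE sqrrN.
  rewrite mulrC ler_pdivrMr // (le_trans (sum_msq_even_drift N f)) // -/E.
  have E0 : 0 <= E by rewrite subr_ge0 msq_iter_le.
  rewrite [leRHS]mulrAC; apply: ler_wpM2r => //.
  have := N_large; lra.
have far : msq (kernel_op A f) <= (1 - delta) ^+ 2 * msq f.
  have -> : kernel_op A f = kernel_op (fun x s => A x s - delta * two_class_kernel x s) f.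
    apply: funext => x; rewrite /kernel_op.
    under [RHS]eq_bigr => y _ do rewrite mulrBl.
    rewrite sumrB; apply/esym/eqP; rewrite subr_eq addrC eq_sym; apply/eqP.
    have -> : \sum_y delta * two_class_kernel x y * f y = 
      delta * (\sum_y pi y * f y + chi x * \sum_y pi y * (chi y * f y)).
      rewrite mulr_sumr -big_split mulr_sumr; apply: eq_bigr => y _ /=.
      by rewrite /two_class_kernel; ring.
    by rewrite f1 fchi mulr0 addr0 mulr0 add0r.
  apply: msq_kernel_op => [x y|||].
  - by rewrite subr_ge0 avg_ge.
  - by rewrite subr_gt0.
  - move=> x; rewrite sumrB lerB //.
      rewrite -mulr_sumr exchange_big /= (eq_bigr (fun=> 1)) => [|r _].
        by rewrite sumr_const card_ord mulVf ?gt_eqF.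
      exact: (stochastic_pow _ mb_stoch).2.
    rewrite -mulr_sumr -[leLHS]mulr1 ler_pM2l //.
    have -> : \sum_y two_class_kernel x y =
        \sum_y pi y + chi x * \sum_y pi y * chi y.
      rewrite mulr_sumr -big_split; apply: eq_bigr => y _ /=.
      by rewrite /two_class_kernel; ring.
    by rewrite pi_sum chi_sum mulr0 addr0.
  move=> y; under eq_bigr => x _ do rewrite mulrBr.
  rewrite sumrB mulrBl mul1r lerB //.
    under eq_bigr => x _ do rewrite mulrCA mulr_sumr.
    rewrite -mulr_sumr exchange_big /= (eq_bigr (fun=> pi y)) => [|r _].
      by rewrite sumr_const card_ord -[pi y *+ N]mulr_natl mulKf ?gt_eqF.
    exact: stationary_pow.
  have -> : \sum_x pi x * (delta * two_class_kernel x y) =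
      delta * (pi y * (\sum_x pi x + chi y * \sum_x pi x * chi x)).
    rewrite mulr_sumr -big_split !mulr_sumr; apply: eq_bigr => x _ /=.
    by rewrite /two_class_kernel; ring.
  by rewrite pi_sum chi_sum mulr0 addr0 mulr1.
(* |f|^2 <= (1+delta)|Af|^2 + (1+1/delta)|f-Af|^2 *)
have split : delta * msq f <=
    delta * (1 + delta) * msq (kernel_op A f) + (1 + delta) * msq (f - kernel_op A f).
  rewrite /msq !mulr_sumr -big_split; apply: ler_sum => x _ /=.
  rewrite mulrCA [X in _ <= X + _]mulrCA [X in _ <= _ + X]mulrCA -mulrDr.
  rewrite ler_wpM2l // !fctE; set u := kernel_op A f x; set v := f x.
  rewrite -subr_ge0.
  have -> : delta * (1 + delta) * u ^+ 2 + (1 + delta) * (v - u) ^+ 2 - delta * v ^+ 2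
     = (delta * u - (v - u)) ^+ 2 by rewrite !expr2; ring.
  exact: sqr_ge0.
have q0 := msq_ge0 f.
have E0 : 0 <= E by rewrite subr_ge0 msq_iter_le.
have d1 : 0 <= 1 - delta by rewrite subr_ge0 ltW.
have h1 : delta * (1 + delta) * msq (kernel_op A f) <= delta * (1 - delta) * msq f.
  rewrite -!mulrA ler_pM2l //.
  apply: le_trans (ler_wpM2l _ far) _; first by rewrite addr_ge0 // ltW.
  rewrite mulrA; apply: ler_wpM2r => //.
  have -> : (1 + delta) * (1 - delta) ^+ 2 = (1 - delta) - (1 - delta) * delta ^+ 2.
    by rewrite !expr2; ring.
  by rewrite gerBl mulr_ge0 ?sqr_ge0.
have h2 : (1 + delta) * msq (f - kernel_op A f) <= 10 * E.
  apply: (@le_trans _ _ (2 * (5 * E))); last lra.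
  apply: ler_pM near => //; [by rewrite addr_ge0 // ltW|exact: msq_ge0|lra].
have : delta * msq f <= delta * (1 - delta) * msq f + 10 * E.
  by apply: le_trans split _; apply: lerD.
by rewrite /E expr2; lra.
Qed.

Hypothesis chi_norm : \sum_x pi x * chi x ^+ 2 = 1.
Variable lambda : R.
Hypotheses (m_chi : kernel_op m chi = chi).
Hypotheses (b_chi : kernel_op b chi = fun x => lambda * chi x).
Hypothesis lambda_le : (lambda ^+ N.*2) ^+ 2 <= 1 - delta ^+ 2 / 10.

(** [chi] is an eigenvector of both [P] and its adjoint, so the iterates of the
component along [chi] and of the rest remain orthogonal. *)
Lemma msq_contract f : \sum_x pi x * f x = 0 ->
  msq (iter N.*2 P f) <= (1 - delta ^+ 2 / 10) * msq f.
Proof.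
move=> f1; set a := inner chi f; set T := N.*2.
pose aa t x : R := - a * (lambda ^+ t * chi x); pose g := f + aa 0.
have fE : f = g - aa 0 by rewrite /g addrK.
have chi_iter t : iter t P' chi = fun x => lambda ^+ t * chi x.
  elim: t => [|t IHt]; first by apply: funext => x; rewrite mul1r.
  rewrite iterS IHt P'E !kernel_opZ m_chi b_chi; apply: funext => x.
  by rewrite /= mulrA -exprSr.
have aa_iter t : iter t P (aa 0) = aa t.
  elim: t => [//|t IHt]; rewrite iterS IHt PE !kernel_opZ b_chi !kernel_opZ m_chi.
  by apply: funext => x; rewrite /aa /= [lambda ^+ t * _]mulrA -exprSr.
have iterPB t u v : iter t P (u - v) = iter t P u - iter t P v.
  by elim: t => //= t ->; apply: kernel_opB.
have chiE : inner chi chi = 1 by [].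
have aa_inner t h : inner h (aa t) = - a * lambda ^+ t * inner chi h.
  rewrite /inner mulr_sumr; apply: eq_bigr => x _; rewrite /aa; ring.
have g1 : \sum_x pi x * g x = 0.
  have -> : \sum_x pi x * g x = \sum_x pi x * f x - a * \sum_x pi x * chi x.
    rewrite mulr_sumr -sumrB; apply: eq_bigr => x _.
    by rewrite /g fctE /aa; ring.
  by rewrite f1 chi_sum mulr0 subrr.
have gchi : inner chi g = 0.
  have -> : inner chi g = inner chi f - a * inner chi chi.
    rewrite /inner mulr_sumr -sumrB; apply: eq_bigr => x _.
    by rewrite /g fctE /aa; ring.
  by rewrite chiE mulr1 subrr.
have gchiT : inner chi (iter T P g) = 0.
  rewrite P_adj chi_iter -[RHS](mulr0 (lambda ^+ T)) -gchi mulr_sumr.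
  by apply: eq_bigr => x _; ring.
have aaq t : msq (aa t) = a ^+ 2 * (lambda ^+ t) ^+ 2.
  rewrite msqE aa_inner -[RHS]mulr1 -chiE /inner !mulr_sumr.
  by apply: eq_bigr => x _; rewrite /aa !expr2; ring.
rewrite [in leLHS]fE iterPB aa_iter msqB aa_inner gchiT mulr0 mulr0 subr0 aaq.
rewrite [in leRHS]fE msqB aa_inner gchi mulr0 mulr0 subr0 aaq expr0 expr1n mulr1.
rewrite mulrDr lerD // ?(msq_contract_orth g1) // mulrC.
by rewrite ler_wpM2r ?sqr_ge0.
Qed.

End TwoReflections.
End MeanSquare.

(** * The sampler and its two reflections *)

Section Sampler.
Variables (R : realType) (n : nat) (p : 'I_n -> R).
Hypothesis p_gt0 : forall i, 0 < p i.
Hypothesis p_sum : \sum_i p i = 1.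
Implicit Types (x y s w : state n) (f : state n -> R).

Definition turn x : state n := (~~ x.1, x.2).

Lemma turnK : involutive turn.
Proof. by case=> e i; rewrite /turn negbK. Qed.

Notation move := (dhn_move p).
Notation accept := (accept_prob p).
Notation target := (dhn_stationary p).

Definition steps_to x y := (y.1 == ~~ x.1) && (label y.2 == label x.2 + eps_of x).

Lemma steps_toE x y :
  steps_to x y = (y.1 == ~~ x.1) && (if x.1 then y.2 == x.2.+1 :> nat else y.2.+1 == x.2).
Proof.
case: x y => [ex ix] [ey iy]; rewrite /steps_to /label /eps_of /=; congr (_ && _).
case: ex; lia.
Qed.

Lemma steps_to_sym x y : steps_to x y = steps_to y x.
Proof.
rewrite !steps_toE; case: x y => [[] ix] [[] iy] //=; lia.
Qed.

Lemma extend0_label i : extend0 p (label i) = p i.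
Proof.
rewrite /extend0 (bigD1 i) //= big1 ?addr0 // => j /andP[/eqP ji /negP]; case.
apply/eqP/val_inj => /=; move: ji; rewrite /label; lia.
Qed.

Lemma accept_ge0 x : 0 <= accept x.
Proof.
rewrite /accept_prob le_min ler01 divr_ge0 ?(ltW (p_gt0 _)) //.
by apply: sumr_ge0 => i _; rewrite ltW.
Qed.

Lemma accept_le1 x : accept x <= 1.
Proof. by rewrite /accept_prob ge_min lexx. Qed.

Lemma accept_step x y : steps_to x y -> accept x = Num.min 1 (p y.2 / p x.2).
Proof. by case/andP => _ /eqP xy; rewrite /accept_prob -xy extend0_label. Qed.

Lemma accept_blocked x : (forall y, ~~ steps_to x y) -> accept x = 0.
Proof.
move=> h; rewrite /accept_prob /extend0 big_pred0 ?mul0r ?min_r // => i.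
by apply/negbTE; have := h (~~ x.1, i); rewrite /steps_to /= eqxx.
Qed.

Lemma accept_uphill x y : steps_to x y -> p x.2 <= p y.2 -> accept x = 1.
Proof.
by move=> xy pxy; rewrite (accept_step xy) min_l // ler_pdivlMr // mul1r.
Qed.

Lemma moveE x y :
  move x y = accept x * (steps_to x y)%:R + (1 - accept x) * (y == x)%:R.
Proof. by []. Qed.

Lemma target_gt0 x : 0 < target x.
Proof. by rewrite divr_gt0. Qed.

Lemma sum_state (F : state n -> R) :
  \sum_x F x = \sum_i F (true, i) + \sum_i F (false, i).
Proof.
transitivity (\sum_(x : bool * 'I_n) F (x.1, x.2)).
  by apply: eq_bigr => -[].
by rewrite -(pair_bigA _ (fun e i => F (e, i))) big_bool.
Qed.

Lemma target_sum : \sum_x target x = 1.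
Proof. by rewrite sum_state /target /= -mulr_suml p_sum -splitr. Qed.

Lemma target_turn x : target (turn x) = target x.
Proof. by []. Qed.

Lemma move_reversible : reversible target move.
Proof.
move=> x y; have [->//|xy] := eqVneq x y.
rewrite !moveE (negPf xy) eq_sym (negPf xy) !mulr0 !addr0 [steps_to y x]steps_to_sym.
case: (boolP (steps_to x y)) => [sxy|_]; last by rewrite !mulr0.
have syx : steps_to y x by rewrite steps_to_sym.
rewrite !mulr1 (accept_step sxy) (accept_step syx) /dhn_stationary.
rewrite mulrAC [in RHS]mulrAC; congr (_ / _).
rewrite !minr_pMr ?(ltW (p_gt0 _)) // !mulr1 !(mulrC (p _) (_ / _)) !divfK ?gt_eqF //.
exact: minC.
Qed.

Lemma steps_to_inj x y w : steps_to x y -> steps_to x w -> y = w.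
Proof.
rewrite !steps_toE; case: x y w => [ex ix] [ey iy] [ew iw] /=.
move=> /andP[/eqP -> hy] /andP[/eqP -> hw]; congr (_, _); apply: val_inj => /=.
by case: ex hy hw => /eqP hy /eqP hw; lia.
Qed.

Lemma move_sum x : \sum_y move x y = 1.
Proof.
have id1 : \sum_y (y == x)%:R = 1 :> R.
  by rewrite (bigD1 x) //= eqxx big1 ?addr0 // => y /negPf ->.
rewrite big_split -!mulr_sumr /= id1 mulr1.
have [/existsP[y xy]|/existsPn h] := boolP [exists y, steps_to x y]; last first.
  by rewrite accept_blocked // mul0r subr0 add0r.
rewrite (bigD1 y) //= -/(steps_to x y) xy big1 ?addr0 => [|w wy].
  by rewrite mulr1 addrC subrK.
case: (boolP (_ && _)) => // xw; case/eqP: wy; exact: steps_to_inj xw xy.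
Qed.

Lemma move_stochastic : stochastic move.
Proof.
split=> [x y|]; last exact: move_sum.
by rewrite addr_ge0 ?mulr_ge0 ?ler0n ?accept_ge0 ?subr_ge0 ?accept_le1.
Qed.

Section Sign.
Variable theta : R.

Lemma sign_op f x :
  kernel_op (dhn_sign theta) f x = (1 - theta) * f (turn x) + theta * f x.
Proof.
rewrite /kernel_op; under eq_bigr => y _ do rewrite mulrDl -!mulrA.
rewrite big_split -!mulr_sumr /=; congr (_ * _ + _ * _).
  by rewrite (bigD1 (turn x)) //= eqxx mul1r big1 ?addr0 // => y /negPf ->; rewrite mul0r.
by rewrite (bigD1 x) //= eqxx mul1r big1 ?addr0 // => y /negPf ->; rewrite mul0r.
Qed.

Lemma sign_reversible : reversible target (dhn_sign theta).
Proof.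
move=> x y; have [->//|xy] := eqVneq x y.
rewrite /dhn_sign -/(turn x) -/(turn y) [y == x]eq_sym (negPf xy) !mulr0 !addr0.
rewrite [x == _]eq_sym (can2_eq turnK turnK).
by case: eqVneq => [->|]; rewrite ?mulr0 // target_turn.
Qed.

Hypotheses (theta_ge0 : 0 <= theta) (theta_le1 : theta <= 1).

Lemma sign_stochastic : stochastic (@dhn_sign R n theta).
Proof.
split=> [x y|x]; first by rewrite addr_ge0 ?mulr_ge0 ?ler0n ?subr_ge0.
have := sign_op (fun=> 1) x; rewrite /kernel_op.
by under eq_bigr do rewrite mulr1; move=> ->; rewrite !mulr1 subrK.
Qed.

Lemma sampler_stochastic : stochastic (dhn_sampler theta p).
Proof. exact: stochastic_comp move_stochastic sign_stochastic. Qed.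

Lemma sampler_stationary : stationary target (dhn_sampler theta p).
Proof.
apply: stationary_comp; apply: reversible_stationary.
- exact: move_reversible.
- exact: move_stochastic.
- exact: sign_reversible.
- exact: sign_stochastic.
Qed.

(** The sign stage fixes the functions even in the direction and multiplies the
odd ones by [- (1 - 2 theta)], so its loss and [f - B f] both measure the odd
part of [f]. *)
Lemma sign_loss f :
  theta * msq target (f - kernel_op (dhn_sign theta) f)
  <= msq target f - msq target (kernel_op (dhn_sign theta) f).
Proof.
set D := \sum_x target x * (f x - f (turn x)) ^+ 2.
have D0 : 0 <= D by apply: sumr_ge0 => x _; rewrite mulr_ge0 ?sqr_ge0 ?ltW ?target_gt0.
have turn_sum : \sum_x target x * f (turn x) ^+ 2 = msq target f.
  by rewrite [RHS](reindex_inj (inv_inj turnK)).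
have -> : msq target (f - kernel_op (dhn_sign theta) f) = (1 - theta) ^+ 2 * D.
  rewrite mulr_sumr; apply: eq_bigr => x _; rewrite !fctE sign_op !expr2; ring.
have -> : msq target f - msq target (kernel_op (dhn_sign theta) f)
    = theta * (1 - theta) * D.
  have -> : msq target (kernel_op (dhn_sign theta) f) = 
     (1 - theta) * \sum_x target x * f (turn x) ^+ 2 + theta * msq target f
     - theta * (1 - theta) * D.
    rewrite !mulr_sumr -big_split -sumrB; apply: eq_bigr => x _ /=.
    rewrite sign_op !expr2; ring.
  rewrite turn_sum; ring.
rewrite mulrA; apply: ler_wpM2r => //; rewrite expr2 mulrA ler_piMr //.
  by rewrite mulr_ge0 ?subr_ge0.
by rewrite gerBl.
Qed.

End Sign.

(** Up to a global sign, the parity of the position on the cycle of length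
[2 n] formed by the two directions.  Shifts and jumps change it, flips and
stationary moves do not. *)
Definition parity x : R := (-1) ^+ (x.1 + x.2).

Lemma parity_turn x : parity (turn x) = - parity x.
Proof. by rewrite /parity /turn; case: x => [[] i] /=; rewrite ?add0n ?add1n exprS mulN1r ?opprK. Qed.

Lemma parity_sqr x : parity x ^+ 2 = 1.
Proof. exact: sqrr_sign. Qed.

Lemma parity_step x y : steps_to x y -> parity y = parity x.
Proof.
rewrite steps_toE /parity -signr_odd -[in RHS]signr_odd => h; congr (_ ^+ _).
case: x y h => [[] ix] [[] iy] //=; lia.
Qed.

Lemma move_parity : kernel_op move parity = parity.
Proof.
apply: funext => x; rewrite -[RHS]mulr1 -(move_sum x) mulr_sumr.
apply: eq_bigr => y _; rewrite mulrC.
rewrite moveE; case: (boolP (steps_to x y)) => [/parity_step -> //|_].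
by rewrite mulr0 add0r; case: eqVneq => [->|]; rewrite ?mulr0 ?mul0r.
Qed.

Lemma sign_parity theta :
  kernel_op (dhn_sign theta) parity = fun x => - (1 - 2 * theta) * parity x.
Proof. by apply: funext => x; rewrite sign_op parity_turn; ring. Qed.

Lemma parity_sum : \sum_x target x * parity x = 0.
Proof.
suff: \sum_x target x * parity x = - \sum_x target x * parity x by lra.
rewrite -sumrN [LHS](reindex_inj (inv_inj turnK)); apply: eq_bigr => x _ /=.
by rewrite target_turn parity_turn mulrN.
Qed.

Lemma parity_norm : \sum_x target x * parity x ^+ 2 = 1.
Proof. by under eq_bigr => x _ do rewrite parity_sqr mulr1; exact: target_sum. Qed.

End Sampler.

Arguments turnK {n}.

(** * The sampler without flips *)

Section NoFlip.
Variables (R : realType) (n : nat) (p : 'I_n -> R).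
Hypothesis p_gt0 : forall i, 0 < p i.
Hypothesis p_sum : \sum_i p i = 1.
Implicit Types (x y s w : state n) (f : state n -> R).

Notation K := (dhn_sampler 0 p).
Notation target := (dhn_stationary p).

Lemma sum_delta (F : state n -> R) y : \sum_s F s * (y == s)%:R = F y.
Proof.
rewrite (bigD1 y) //= eqxx mulr1 big1 ?addr0 // => s /negPf sy.
by rewrite eq_sym sy mulr0.
Qed.

Lemma sampler_move theta x y : dhn_sampler theta p x y =
  (1 - theta) * dhn_move p x (turn y) + theta * dhn_move p x y.
Proof.
rewrite -(sum_delta (dhn_move p x) y) -(sum_delta (dhn_move p x) (turn y)) !mulr_sumr -big_split.
apply: eq_bigr => s _ /=; rewrite /dhn_sign -/(turn s).
by rewrite (can2_eq turnK turnK) mulrDr mulrCA [X in _ + X]mulrCA.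
Qed.

Lemma noflipE x y : K x y = dhn_move p x (turn y).
Proof. by rewrite sampler_move subr0 mul1r mul0r addr0. Qed.

Lemma noflip_stochastic : stochastic K.
Proof. by apply: sampler_stochastic => //; exact: ler01. Qed.

Lemma noflip_stationary : stationary target K.
Proof. by apply: sampler_stationary => //; exact: ler01. Qed.

Lemma noflip_skew x y : target x * K x y = target y * K (turn y) (turn x).
Proof. by rewrite !noflipE turnK (move_reversible p_gt0) target_turn. Qed.

Lemma sampler_noflip theta x y :
  dhn_sampler theta p x y = (1 - theta) * K x y + theta * K x (turn y).
Proof. by rewrite !noflipE turnK sampler_move. Qed.

Lemma noflip_op_accept f x y :
  steps_to x y -> accept_prob p x = 1 -> kernel_op K f x = f (turn y).
Proof.
move=> xy ax; rewrite /kernel_op (bigD1 (turn y)) //= noflipE turnK moveE ax xy.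
rewrite subrr mul0r addr0 mulr1 mul1r big1 ?addr0 // => w wy.
rewrite noflipE moveE ax subrr mul0r addr0 mul1r.
case: (boolP (steps_to x _)) => [xw|]; last by rewrite mul0r.
by case/eqP: wy; rewrite -(turnK w) (steps_to_inj xw xy).
Qed.

Lemma noflip_parity t x s :
  kernel_pow K t x s * parity R s = (-1) ^+ t * (parity R x * kernel_pow K t x s).
Proof.
elim: t x => [|t IHt] x.
  rewrite /= /kernel_id expr0 mul1r; case: eqVneq => [->|_]; first by rewrite mulrC.
  by rewrite mul0r mulr0.
rewrite kernel_powS /kernel_op mulr_suml !mulr_sumr; apply: eq_bigr => y _.
rewrite -mulrA IHt noflipE moveE.
have -> : parity R y = - parity R (turn y) by rewrite parity_turn opprK.
rewrite exprS.
case: (boolP (steps_to x _)) => [/(parity_step R) ->|_]; last first.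
  rewrite mulr0 add0r; case: eqVneq => [->|_]; first ring.
  by rewrite mulr0 !(mul0r, mulr0).
case: eqVneq => [e|_]; first by rewrite ?e; ring.
ring.
Qed.

Variable j : 'I_n.
Hypothesis p_up : forall a b : 'I_n, (a <= b)%N -> (b <= j)%N -> p a <= p b.
Hypothesis p_down : forall a b : 'I_n, (j <= a)%N -> (a <= b)%N -> p b <= p a.

(** Going uphill is certain, so the direction can change only when not going
uphill. *)
Lemma noflip_neq0 x y : K x y != 0 ->
  (y.1 = x.1 /\ (if x.1 then (y.2 : nat) = x.2.+1 else (y.2 : nat).+1 = x.2)) \/
  (y = turn x /\ (if x.1 then (j <= x.2)%N else (x.2 <= j)%N)).
Proof.
rewrite noflipE moveE => h; case: (boolP (steps_to x (turn y))) => [xy|nxy].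
  left; move: xy; rewrite steps_toE /= => /andP[/eqP/negb_inj -> /=].
  by case: x.1 => /eqP.
have ytx : y = turn x.
  move: h; rewrite (negPf nxy) mulr0 add0r.
  case: (eqVneq (turn y) x) => [<- _|_]; first by rewrite turnK.
  by rewrite mulr0 eqxx.
right; split=> //; apply: contraT => up; case/eqP: h.
rewrite (negPf nxy) mulr0 add0r.
suff -> : accept_prob p x = 1 by rewrite subrr mul0r.
case: x up {nxy ytx} => [[] i] /=; rewrite -ltnNge => ij.
  have lt : (i.+1 < n)%N by apply: leq_ltn_trans ij _.
  apply: (@accept_uphill _ _ _ p_gt0 _ (false, Ordinal lt)); first by rewrite steps_toE /=.
  exact: p_up.
have lt : (i.-1 < n)%N by have := ltn_ord i; lia.
apply: (@accept_uphill _ _ _ p_gt0 _ (true, Ordinal lt)).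
  by rewrite steps_toE /=; lia.
by apply: p_down => /=; lia.
Qed.

Definition top (e : bool) : state n := (e, j).

(** The number of steps along the cycle of the two directions from [x] to
[top e]: a jump only cuts this path short. *)
Definition cycle_dist (e : bool) x : nat :=
  if x.1 == e then
    if e then (if x.2 <= j then j - x.2 else 2 * n + j - x.2)%N
    else (if j <= x.2 then x.2 - j else 2 * n + x.2 - j)%N
  else if e then (x.2 + j).+1 else (2 * n - 1 - x.2 - j)%N.

Lemma cycle_dist_le e x : (cycle_dist e x <= 2 * n)%N.
Proof.
rewrite /cycle_dist; have := ltn_ord x.2; have := ltn_ord j.
by case: e; case: x => [[] i] /=; do ?case: ifP; lia.
Qed.

Lemma cycle_dist_lt e x y : x != top e -> K x y != 0 ->
  (cycle_dist e y < cycle_dist e x)%N.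
Proof.
move=> xo; have {xo} : ~ (x.1 = e /\ (x.2 : nat) = j).
  move=> [e1 e2]; case/eqP: xo; rewrite /top -e1 [x]surjective_pairing /=.
  by congr (_, _); exact: val_inj.
have := ltn_ord x.2; have := ltn_ord y.2; have := ltn_ord j.
move=> jn yn xn xo /noflip_neq0; rewrite /cycle_dist.
case: x y xo yn xn => [ex ix] [ey iy] /= xo yn xn [[-> h]|[[-> ->] h]];
  by case: e xo; case: ex h => /= h xo; do ?case: ifP; lia.
Qed.

Lemma occupation_noflip_ge M x s :
  M%:R * target s <= occupation K (M + 4 * n) x s.
Proof.
have -> : (M + 4 * n = M + 2 * n + 2 * n)%N by lia.
apply: (occupation_lower (o := top true) (sig := @turn n)
  (rank := cycle_dist true) (rank' := cycle_dist false) noflip_stochastic).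
- exact: target_gt0.
- exact: target_sum.
- exact: noflip_stationary.
- exact: turnK.
- by [].
- exact: noflip_skew.
- exact: cycle_dist_lt.
- exact: cycle_dist_le.
- exact: cycle_dist_lt.
- exact: cycle_dist_le.
Qed.

Lemma occupation_noflip_le M e s :
  occupation K M (top e) s <= (M + 2 * n)%:R * target s.
Proof.
apply: (occupation_upper (sig := @turn n) (rank' := cycle_dist (~~ e)) noflip_stochastic).
- exact: target_gt0.
- exact: target_sum.
- exact: noflip_stationary.
- exact: turnK.
- by [].

- exact: noflip_skew.
- exact: cycle_dist_lt.
- exact: cycle_dist_le.
Qed.

(** * Trajectories leaving the mode and returning to it *)

Definition dist x : nat := ((x.2 - j) + (j - x.2))%N.

Lemma dist_lt x : (dist x < n)%N.
Proof. by rewrite /dist; have := ltn_ord x.2; have := ltn_ord j; lia. Qed.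

Definition outbound x : bool := if x.1 then (j <= x.2)%N else (x.2 <= j)%N.

Lemma outbound_turn w : outbound w || outbound (turn w).
Proof. by rewrite /outbound; case: w => [[] i] /=; lia. Qed.

Lemma noflip_far t x s : (dist s + t < dist x)%N -> kernel_pow K t x s = 0.
Proof.
elim: t x => [|t IHt] x h /=.
  by rewrite /kernel_id; case: eqVneq h => // ->; lia.
apply: big1 => y _; have [->|/noflip_neq0 kxy] := eqVneq (K x y) 0; first exact: mul0r.
rewrite IHt ?mulr0 //; move: h; rewrite /dist.
case: kxy => [[_]|[-> _]] /=; last lia.
by case: x.1; lia.
Qed.

Definition passage l x : R :=
  \sum_(w | outbound w && (dist w <= l)%N) kernel_pow K (l - dist w) x w.

(** From an outbound state [w], the chain must spend a step on changing its
direction before it approaches the mode; so it cannot be [d] steps closer after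
only [d] steps.  Hence the events of being at [w] at time [l - dist w], for the
various outbound [w], exclude each other. *)
Lemma passage_le1 l x : passage l x <= 1.
Proof.
elim: l x => [|l IHl] x.
  apply: (@le_trans _ _ (\sum_w kernel_pow K 0 x w)).
    rewrite [leRHS](bigID (fun w => outbound w && (dist w <= 0)%N)) /=.
    by rewrite lerDl sumr_ge0 // => w _; exact: ler0n.
  by rewrite (stochastic_pow 0 noflip_stochastic).2.
have split : passage l.+1 x =
    (outbound x && (dist x == l.+1))%:R + kernel_op K (passage l) x.
  rewrite /passage (bigID (fun w => dist w == l.+1)) /=; congr (_ + _).
    case: (boolP (_ && _)) => [/andP[ox /eqP dx]|nx].
      rewrite (bigD1 x) /=; last by rewrite ox dx leqnn eqxx.
      rewrite dx subnn /= /kernel_id eqxx big1 ?addr0 // => w /andP[/andP[_ /eqP ->]].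
      by rewrite subnn /= /kernel_id eq_sym => /negPf ->.
    apply: big1 => w /andP[/andP[ow _] dw]; rewrite (eqP dw) subnn /= /kernel_id.
    by case: (eqVneq x w) nx => // ->; rewrite ow dw.
  rewrite kernel_op_sum; apply: eq_big => [w|w /andP[/andP[_ dw] dw']].
    by case: (outbound w) => //=; lia.
  by rewrite subSn //; lia.
have le1 : kernel_op K (passage l) x <= 1.
  rewrite -[leRHS](congr1 (@^~ x) (stochastic_op1 1 noflip_stochastic)).
  by apply: ler_kernel_op => //; exact: noflip_stochastic.1.
rewrite split; case: (boolP (_ && _)) => [/andP[ox /eqP dx]|]; last by rewrite add0r.
rewrite (_ : kernel_op _ _ _ = 0) ?addr0 //; apply: big1 => y _.
have [->|/noflip_neq0 kxy] := eqVneq (K x y) 0; first exact: mul0r.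
rewrite (_ : passage l y = 0) ?mulr0 //; apply: big1 => w /andP[_ dw].
apply: noflip_far; rewrite subnKC // -ltnS -dx.
case: kxy ox; rewrite /dist /outbound => -[]; last by move=> -> _ /=; rewrite ltnS.
by move=> _; case: x.1; lia.
Qed.

(** A state whose turn is outbound faces the mode: it goes uphill for certain. *)
Lemma noflip_return t w s : outbound w -> (dist w <= t)%N ->
  kernel_pow K t (turn w) s = kernel_pow K (t - dist w) (top (~~ w.1)) s.
Proof.
have [d] := ubnP (dist w); elim: d w t => // d IHd w t wd ow wt.
have [dw0|dw0] := eqVneq (dist w) 0%N.
  rewrite dw0 subn0 /turn /top; congr (kernel_pow _ _ (_, _) _).
  by apply: ord_inj; move: dw0; rewrite /dist; lia.
case: t wt => [|t] wt; first by move: dw0 wt; lia.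
have [i [si ui pi ii]] : exists i : 'I_n,
  [/\ steps_to (turn w) (w.1, i), outbound (w.1, i), p w.2 <= p i & (dist (w.1, i)).+1 = dist w].
  case: w ow dw0 {wd wt} => [[] i] /=; rewrite /outbound /dist /= => ow dw0.
    have lt : (i.-1 < n)%N by have := ltn_ord i; lia.
    exists (Ordinal lt); split => /=; try lia; first by rewrite steps_toE /=; lia.
    by apply: p_down => /=; lia.
  have lt : (i.+1 < n)%N by have := ltn_ord j; lia.
  exists (Ordinal lt); split => /=; try lia; first by rewrite steps_toE /=; lia.
  by apply: p_up => /=; lia.
rewrite kernel_powS (noflip_op_accept _ si) ?(accept_uphill p_gt0 si) //.
by rewrite IHd // -?ii ?subSS // -ltnS ii.
Qed.

End NoFlip.

Local Arguments kernel_pow : simpl never.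

Section ReturnLaw.
Variables (R : realType) (n : nat) (p : 'I_n -> R).
Hypothesis p_gt0 : forall i, 0 < p i.
Hypothesis p_sum : \sum_i p i = 1.
Variable j : 'I_n.
Hypothesis p_up : forall a b : 'I_n, (a <= b)%N -> (b <= j)%N -> p a <= p b.
Hypothesis p_down : forall a b : 'I_n, (j <= a)%N -> (a <= b)%N -> p b <= p a.

Implicit Types (x y s w : state n).

Notation K := (dhn_sampler 0 p).
Notation target := (dhn_stationary p).
Notation outbound := (outbound j).
Notation dist := (dist j).

Let K0 x y : 0 <= K x y. Proof. exact: (noflip_stochastic p_gt0).1. Qed.
Let Kt0 t x y : 0 <= kernel_pow K t x y.
Proof. exact: (stochastic_pow t (noflip_stochastic p_gt0)).1. Qed.
(** Trajectories that make their only flip at an outbound state and are then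
taken back to the mode; [l] is the time of arrival there. *)
Definition return_law v x s : R :=
  \sum_(l < v.+1) \sum_(w | outbound w && (dist w <= l)%N)
    kernel_pow K (l - dist w).+1 x w * kernel_pow K (v - l) (top j (~~ w.1)) s.

Lemma return_law_ge0 v x s : 0 <= return_law v x s.
Proof. by apply: sumr_ge0 => l _; apply: sumr_ge0 => w _; rewrite mulr_ge0. Qed.

Lemma sum_delay (F : nat -> R) v d :
  \sum_(l < v.+1 | (d <= l)%N) F (l - d)%N = \sum_(a < v.+1 - d) F a.
Proof.
rewrite -(big_mkord (fun l => d <= l)%N (fun l => F (l - d)%N)) -(big_mkord xpredT F).
have [vd|dv] := ltnP v d.
  rewrite (_ : v.+1 - d = 0)%N; last by lia.
  rewrite [RHS]big_geq // big_nat_cond big_pred0 // => l; lia.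
rewrite (big_cat_nat (leq0n d) (leqW dv)) /= big_nat_cond big_pred0 ?add0r; last first.
  by move=> l; lia.
rewrite -{1}[d]add0n big_addn; apply: eq_big => [l|l _]; first by rewrite leq_addl.
by rewrite addnK.
Qed.

(** By [passage_le1] every arrival time has weight at most 1, so that only two
occupations starting at the mode remain. *)
Lemma return_law_le v x s :
  return_law v x s <= 2 * (v.+1 + 2 * n)%:R * target s.
Proof.
pose H l := kernel_pow K (v - l) (top j true) s + kernel_pow K (v - l) (top j false) s.
apply: (@le_trans _ _ (\sum_(l < v.+1) H l)).
  apply: ler_sum => l _.
  apply: (@le_trans _ _ (kernel_op K (passage p j l) x * H l)).
    rewrite kernel_op_sum mulr_suml; apply: ler_sum => w _.
    apply: ler_wpM2l; first by apply: sumr_ge0 => y _; rewrite mulr_ge0.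
    by rewrite /H; case: w.1; rewrite /= ?lerDl ?lerDr.
  rewrite -[leRHS]mul1r ler_wpM2r ?addr_ge0 //.
  rewrite -[leRHS](congr1 (@^~ x) (stochastic_op1 1 (noflip_stochastic p_gt0))).
  by apply: ler_kernel_op => // y; exact: passage_le1.
rewrite big_split /= -mulrA mulr2n mulrDl mul1r.
have rev e : \sum_(l < v.+1) kernel_pow K (v - l) (top j e) s =
    occupation K v.+1 (top j e) s.
  rewrite (reindex_inj rev_ord_inj); apply: eq_bigr => l _ /=.
  by rewrite subSS subKn // -ltnS.
by rewrite !rev lerD // occupation_noflip_le.
Qed.

Lemma target_outbound : 2^-1 <= \sum_(w | outbound w) target w.
Proof.
have : 1 <= \sum_(w | outbound w) target w + \sum_(w | outbound w) target w.
  rewrite -(target_sum p_sum) (bigID outbound) /= lerD2l.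
  rewrite [leLHS](reindex_inj (inv_inj turnK)) /=.
  rewrite big_mkcond [leRHS]big_mkcond; apply: ler_sum => w _ /=.
  rewrite target_turn; have := ltW (target_gt0 p_gt0 w).
  by have := outbound_turn j w; case: (outbound w); case: (outbound (turn w)).
lra.
Qed.

(** The law loses [n] steps for the return to the mode and [4 n] for the
occupation bound; the factor 1/2 is the mass of the outbound states. *)
Lemma return_law_mass v x :
  (v.+1 - 5 * n)%:R / 2 <= \sum_s return_law v x s.
Proof.
have [vn|nv] := ltnP v.+1 (5 * n).
  rewrite (_ : v.+1 - 5 * n = 0)%N; last by lia.
  by rewrite mul0r sumr_ge0 // => s _; exact: return_law_ge0.
apply: (@le_trans _ _ (\sum_(w | outbound w) (v.+1 - 5 * n)%:R * target w)).
  by rewrite -mulr_sumr ler_wpM2l // target_outbound.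
have -> : \sum_s return_law v x s =
    \sum_(l < v.+1) \sum_(w | outbound w && (dist w <= l)%N)
      kernel_pow K (l - dist w).+1 x w.
  rewrite exchange_big; apply: eq_bigr => l _ /=.
  rewrite exchange_big; apply: eq_bigr => w _ /=; rewrite -mulr_sumr.
  by rewrite (stochastic_pow _ (noflip_stochastic p_gt0)).2 mulr1.
rewrite (exchange_big_dep outbound) /=; last by move=> l w _ /andP[].
apply: ler_sum => w ow; rewrite ow /=.
rewrite (sum_delay (fun a => kernel_pow K a.+1 x w)).
have -> : \sum_(a < v.+1 - dist w) kernel_pow K a.+1 x w =
    kernel_op K (occupation K (v.+1 - dist w) ^~ w) x.
  by rewrite /occupation kernel_op_sum.
rewrite -[leLHS](congr1 (@^~ x) (stochastic_op1 _ (noflip_stochastic p_gt0))).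
apply: ler_kernel_op => // y.
apply: le_trans (occupation_noflip_ge p_gt0 p_sum p_up p_down _ y w) _.
apply: (occupation_mono (noflip_stochastic p_gt0)).
by have := dist_lt j w; lia.
Qed.

End ReturnLaw.

(** * The sampler with flips *)

Section Flips.
Variables (R : realType) (n : nat) (p : 'I_n -> R) (theta : R).
Hypothesis p_gt0 : forall i, 0 < p i.
Hypothesis p_sum : \sum_i p i = 1.
Hypotheses (theta_ge0 : 0 <= theta) (theta_le1 : theta <= 1).
Implicit Types (x y s w : state n) (f : state n -> R).

Notation K := (dhn_sampler 0 p).
Notation P := (dhn_sampler theta p).
Notation target := (dhn_stationary p).

Let K0 x y : 0 <= K x y. Proof. exact: (noflip_stochastic p_gt0).1. Qed.
Let Kt0 t x y : 0 <= kernel_pow K t x y.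
Proof. exact: (stochastic_pow t (noflip_stochastic p_gt0)).1. Qed.
Let P0 x y : 0 <= P x y.
Proof. by have [? _] := sampler_stochastic p_gt0 theta_ge0 theta_le1. Qed.
Let Pt0 t x y : 0 <= kernel_pow P t x y.
Proof. exact: (stochastic_pow t (sampler_stochastic p_gt0 theta_ge0 theta_le1)).1. Qed.

Lemma sampler_powS t x s : kernel_pow P t.+1 x s =
  (1 - theta) * kernel_op K (kernel_pow P t ^~ s) x
  + theta * kernel_op K (fun y => kernel_pow P t (turn y) s) x.
Proof.
rewrite kernel_powS /kernel_op.
under eq_bigr => y _ do rewrite sampler_noflip mulrDl -!mulrA.
rewrite big_split -!mulr_sumr /=; congr (_ + _ * _).
by rewrite (reindex_inj (inv_inj turnK)); apply: eq_bigr => y _; rewrite turnK.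
Qed.

Lemma pow_no_flip_le t x s :
  (1 - theta) ^+ t * kernel_pow K t x s <= kernel_pow P t x s.
Proof.
elim: t x => [|t IHt] x; first by rewrite expr0 mul1r.
rewrite sampler_powS exprS -mulrA ler_wpDr //.
  by rewrite mulr_ge0 // sumr_ge0 // => y _; rewrite mulr_ge0.
rewrite ler_wpM2l ?subr_ge0 // -[leLHS]/((fun x => _ * kernel_op K (kernel_pow K t ^~ s) x) x).
rewrite -kernel_opZ.
exact: ler_kernel_op.
Qed.

(** Keep the trajectories whose only flip takes place at the state [w] reached
after [a + 1] steps. *)
Lemma pow_one_flip_le v x s :
  (1 - theta) ^+ v * theta *
    \sum_(a < v.+1) \sum_w kernel_pow K a.+1 x w * kernel_pow K (v - a) (turn w) s
  <= kernel_pow P v.+1 x s.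
Proof.
pose G v x := \sum_(a < v.+1) \sum_w kernel_pow K a.+1 x w * kernel_pow K (v - a) (turn w) s.
pose H v := kernel_op K (fun z => kernel_pow K v (turn z) s).
have G0 y : G 0 y = H 0 y.
  by rewrite /G big_ord1; apply: eq_bigr => w _; rewrite kernel_pow1.
have GS u y : G u.+1 y = H u.+1 y + kernel_op K (G u) y.
  rewrite /G big_ord_recl; congr (_ + _).
    by apply: eq_bigr => w _; rewrite kernel_pow1.
  rewrite kernel_op_sum; apply: eq_bigr => a _; rewrite lift0.
  under eq_bigr => w _ do rewrite subSS kernel_powS mulr_suml.
  rewrite exchange_big; apply: eq_bigr => z _ /=; rewrite mulr_sumr.
  by apply: eq_bigr => w _; rewrite mulrA.
have HP u y : (1 - theta) ^+ u * H u y <= kernel_op K (fun z => kernel_pow P u (turn z) s) y.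
  rewrite -[leLHS](congr1 (@^~ y) (kernel_opZ _ _ _)).
  by apply: ler_kernel_op => // z; exact: pow_no_flip_le.
have t0 : 0 <= 1 - theta by rewrite subr_ge0.
rewrite -/(G v x); elim: v x => [|v IHv] x.
  rewrite G0 sampler_powS [_ * theta]mulrC -mulrA ler_wpDl //.
    by rewrite mulr_ge0 // sumr_ge0 // => y _; rewrite mulr_ge0.
  by rewrite ler_wpM2l.
rewrite GS sampler_powS mulrDr addrC lerD //.
  rewrite exprS -!mulrA ler_wpM2l // mulrA.
  rewrite -[leLHS](congr1 (@^~ x) (kernel_opZ _ _ _)).
  exact: ler_kernel_op.
by rewrite [_ * theta]mulrC -mulrA ler_wpM2l.
Qed.

Variable j : 'I_n.
Hypothesis p_up : forall a b : 'I_n, (a <= b)%N -> (b <= j)%N -> p a <= p b.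
Hypothesis p_down : forall a b : 'I_n, (j <= a)%N -> (a <= b)%N -> p b <= p a.

Notation outbound := (outbound j).
Notation dist := (dist j).

Lemma return_law_le_pow v x s :
  (1 - theta) ^+ v * theta * return_law p j v x s <= kernel_pow P v.+1 x s.
Proof.
apply: le_trans (pow_one_flip_le v x s); apply: ler_wpM2l.
  by rewrite mulr_ge0 // exprn_ge0 // subr_ge0.
rewrite exchange_big /= (bigID outbound) /= ler_wpDr //.
  by apply: sumr_ge0 => w _; apply: sumr_ge0 => a _; rewrite mulr_ge0.
rewrite /return_law (exchange_big_dep outbound) /=; last by move=> l w _ /andP[].
apply: ler_sum => w ow; rewrite ow /=.
pose F a := kernel_pow K a.+1 x w * kernel_pow K (v - a) (turn w) s.
apply: (@le_trans _ _ (\sum_(l < v.+1 | (dist w <= l)%N) F (l - dist w)%N)).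
  apply: ler_sum => l dl; rewrite /F (noflip_return p_gt0 p_up p_down _ ow) //.
    by rewrite (_ : v - (l - dist w) - dist w = v - l)%N //; have := ltn_ord l; lia.
  by have := ltn_ord l; lia.
rewrite sum_delay -!(big_mkord xpredT F).
rewrite [leRHS](big_cat_nat (leq0n _) (leq_subr (dist w) _)) /=.
by rewrite lerDl sumr_ge0 // => a _; rewrite mulr_ge0.
Qed.

End Flips.

(** * Powers of real numbers *)

Lemma bernoulli_ineq (R : realType) (x : R) (n : nat) :
  -1 <= x -> 1 + n%:R * x <= (1 + x) ^+ n.
Proof.
move=> x1; elim: n => [|n IHn]; first by rewrite mul0r addr0 expr0.
rewrite exprS; apply: (@le_trans _ _ ((1 + x) * (1 + n%:R * x))).
  rewrite -natr1; have : 0 <= n%:R * x ^+ 2 by rewrite mulr_ge0 ?sqr_ge0.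
  rewrite expr2; nra.
by rewrite ler_wpM2l //; lra.
Qed.

Lemma exists_exp_le (R : realType) (x e : R) :
  0 < x -> x < 1 -> 0 < e -> exists k, x ^+ k <= e.
Proof.
move=> x0 x1 e0; pose a := x^-1 - 1.
have a0 : 0 < a by rewrite subr_gt0 invf_gt1.
have [k kP] : exists k : nat, e^-1 / a < k%:R.
  exists (Num.bound (e^-1 / a)); apply: archi_boundP.
  by rewrite divr_ge0 ?invr_ge0 // ltW.
exists k; rewrite -[e]invrK -[x]invrK exprVn lef_pV2 ?posrE ?invr_gt0 ?exprn_gt0 ?invr_gt0 //.
have -> : x^-1 = 1 + a by rewrite /a addrC subrK.
apply: le_trans (bernoulli_ineq _ _); last by lra.
move: kP; rewrite ltr_pdivrMr // => kP; apply: ltW; apply: lt_le_trans kP _.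
by rewrite lerDr.
Qed.

Lemma no_flip_prob (R : realType) (n : nat) : (2 <= n)%N ->
  expR (- 2) <= (1 - n%:R^-1) ^+ n :> R.
Proof.
move=> n2; have n0 : 0 < n%:R :> R by rewrite ltr0n; lia.
set t : R := n%:R^-1; have t0 : 0 < t by rewrite invr_gt0.
have t2 : t <= 2^-1 by rewrite lef_pV2 ?posrE // ler_nat.
have -> : - 2 = n%:R * - (2 * t) :> R.
  by rewrite mulrN mulrCA divff ?gt_eqF // mulr1.
rewrite expRM_natl; apply: lerXn2r; rewrite ?nnegrE ?expR_ge0 ?subr_ge0 //; first lra.
rewrite expRN; apply: (@le_trans _ _ (1 + 2 * t)^-1).
  by rewrite lef_pV2 ?posrE ?expR_gt0 ?expR_ge1Dx //; lra.
rewrite -[leLHS]mul1r ler_pdivrMr; last lra.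
nra.
Qed.

(** * From warm starts to total variation *)

Section TotalVariation.
Variables (R : realType) (S : finType).

(** The event on which the first law exceeds the second one realises the
distance. *)
Lemma tv_dist_event (P Q : S -> R) : \sum_s P s = \sum_s Q s ->
  tv_dist P Q = \sum_s P s * (Q s <= P s)%R%:R - \sum_s Q s * (Q s <= P s)%R%:R.
Proof.
move=> PQ; apply: (canLR (mulKf _)); first by rewrite pnatr_eq0.
have e : \sum_s (P s - Q s) = 0 by rewrite sumrB PQ subrr.
rewrite -[RHS]subr0 -[X in _ = _ - X]e -sumrB mulr_sumr -sumrB.
apply: eq_bigr => s _.
case: (lerP (Q s) (P s)) => h; rewrite ?mulr1 ?mulr0.
  by ring.
by ring.
Qed.

Variables (k : S -> S -> R) (pi : S -> R).
Hypotheses (k_stoch : stochastic k) (pi_stat : stationary pi k).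
Hypotheses (pi_ge0 : forall x, 0 <= pi x) (pi_sum : \sum_x pi x = 1).

Lemma tv_dist_osc (z : nat) (r : R) y :
  (forall f, (forall s, 0 <= f s <= 1) -> forall s,
     kernel_op (kernel_pow k z) f y - kernel_op (kernel_pow k z) f s <= r) ->
  tv_dist (kernel_pow k z y) pi <= r.
Proof.
move=> osc; rewrite tv_dist_event; last by rewrite (stochastic_pow z k_stoch).2.
set g := fun s : S => (pi s <= kernel_pow k z y s)%R%:R : R; rewrite -/(kernel_op _ g y).
have -> : \sum_s pi s * g s = \sum_x pi x * kernel_op (kernel_pow k z) g x.
  under [RHS]eq_bigr => x _ do rewrite mulr_sumr.
  rewrite exchange_big; apply: eq_bigr => s _ /=.
  rewrite -(stationary_pow z pi_stat s) mulr_suml.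
  by apply: eq_bigr => x _; rewrite mulrA.
rewrite -[X in X - _]mul1r -pi_sum mulr_suml -sumrB -[leRHS]mul1r -pi_sum mulr_suml.
apply: ler_sum => s _; rewrite -mulrBr ler_wpM2l //; apply: osc => {}s.
by rewrite /g; case: (pi s <= _)%R; rewrite ?mulr1n ?mulr0n ?lexx ?ler01.
Qed.

Hypothesis pi_gt0 : forall x, 0 < pi x.

(** If the law at time [v] dominates a part [mu] of mass at least [a] which is
warm, that is, of bounded density, mean-square contraction brings that part close to
a multiple of [pi], whatever the initial state. *)
Lemma warm_minorization (v T : nat) (mu : S -> R) (a b rho c : R) f x :
  (forall s, 0 <= mu s <= kernel_pow k v x s) ->
  (forall s, mu s <= b * pi s) -> a <= \sum_s mu s -> 0 <= a -> 0 <= b -> 0 <= rho ->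
  (forall g, \sum_s pi s * g s = 0 ->
     msq pi (iter T (kernel_op k) g) <= rho * msq pi g) ->
  b * rho <= (a / 4) ^+ 2 -> (forall s, 0 <= f s <= c) ->
  a * (\sum_s pi s * f s) - a / 4 * c <= kernel_op (kernel_pow k (v + T)) f x.
Proof.
move=> mu01 mub amu a0 b0 rho0 contract small f0c; set u := \sum_s _.
pose h := iter T (kernel_op k) (fun s => f s - u).
have c0 : 0 <= c by have /andP[] := f0c x; apply: le_trans.
have u0 : 0 <= u by apply: sumr_ge0 => s _; case/andP: (f0c s) => *; rewrite mulr_ge0.
have uc : u <= c.
  rewrite -[leRHS]mul1r -pi_sum mulr_suml; apply: ler_sum => s _.
  by rewrite ler_wpM2l //; case/andP: (f0c s).
have opT g : iter T (kernel_op k) g = kernel_op (kernel_pow k T) g.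
  by rewrite kernel_op_pow.
have fT s : kernel_op (kernel_pow k T) f s = u + h s.
  have hE : h = iter T (kernel_op k) (f - (fun=> u)) by [].
  rewrite hE opT kernel_opB stochastic_op1; last exact: stochastic_pow.
  by apply/esym; rewrite addrC; exact: subrK.
have f0 s : 0 <= kernel_op (kernel_pow k T) f s.
  apply: sumr_ge0 => w _; rewrite mulr_ge0 //; last by case/andP: (f0c w).
  exact: (stochastic_pow T k_stoch).1.
have step : \sum_s mu s * (u + h s) <= kernel_op (kernel_pow k (v + T)) f x.
  rewrite kernel_op_pow iterD opT -kernel_op_pow; apply: ler_sum => s _.
  by rewrite -fT ler_wpM2r //; case/andP: (mu01 s).
apply: le_trans step; under eq_bigr => s _ do rewrite mulrDr.
rewrite big_split /= -mulr_suml; apply: lerD; first by rewrite ler_wpM2r.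
suff : `|\sum_s mu s * h s| <= a / 4 * c by rewrite ler_norml => /andP[].
rewrite -ler_sqr ?nnegrE ?normr_ge0 ?mulr_ge0 ?invr_ge0 // -normrX ger0_norm ?sqr_ge0 //.
apply: (@le_trans _ _ (1 * \sum_s mu s * h s ^+ 2)).
  apply: weighted_jensen => // [s|]; first by case/andP: (mu01 s).
  rewrite -[leRHS]((stochastic_pow v k_stoch).2 x).
  by apply: ler_sum => s _; case/andP: (mu01 s).
rewrite mul1r; apply: (@le_trans _ _ (b * msq pi h)).
  rewrite mulr_sumr; apply: ler_sum => s _; rewrite mulrA ler_wpM2r ?sqr_ge0 //.
apply: (@le_trans _ _ (b * (rho * msq pi (fun s => f s - u)))).
  rewrite ler_wpM2l // contract //.
  under eq_bigr => s _ do rewrite mulrBr.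
  by rewrite sumrB -mulr_suml pi_sum mul1r subrr.
rewrite exprMn mulrA; apply: ler_pM => //; first by rewrite mulr_ge0.
  by apply: sumr_ge0 => s _; rewrite mulr_ge0 ?sqr_ge0.
rewrite -[leRHS]mul1r -pi_sum mulr_suml; apply: ler_sum => s _.
rewrite ler_wpM2l // -[leLHS]real_normK ?num_real // lerXn2r ?nnegrE //.
by rewrite ler_norml; case/andP: (f0c s) => *; lra.
Qed.

(** The lower bound for [f - min f] and for its complement to [c] gain [a c]
together, and their two errors cost half of it. *)
Lemma osc_contract (L : nat) (a c : R) f :
  (forall g x, (forall s, 0 <= g s <= c) ->
    a * (\sum_s pi s * g s) - a / 4 * c <= kernel_op (kernel_pow k L) g x) ->
  (forall x y, f x - f y <= c) ->
  forall x y, kernel_op (kernel_pow k L) f x - kernel_op (kernel_pow k L) f y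
    <= (1 - a / 2) * c.
Proof.
move=> minor osc x y.
have [x0 x0P] : exists x0, forall s, f x0 <= f s.
  by exists [arg min_(s < x) f s]%O; case: arg_minP => // s _ h t; exact: h.
have opc c1 z : kernel_op (kernel_pow k L) (fun=> c1) z = c1.
  by rewrite stochastic_op1 //; exact: stochastic_pow.
have opB g h z : kernel_op (kernel_pow k L) (g - h) z =
    kernel_op (kernel_pow k L) g z - kernel_op (kernel_pow k L) h z.
  by rewrite kernel_opB.
set u := \sum_s pi s * f s.
have lo : a * (u - f x0) - a / 4 * c <= kernel_op (kernel_pow k L) f y - f x0.
  rewrite -{2}(opc (f x0) y) -opB.
  have -> : u - f x0 = \sum_s pi s * (f - (fun=> f x0)) s.
    under eq_bigr => s _ do rewrite mulrBr.
    by rewrite sumrB -mulr_suml pi_sum mul1r.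
  by apply: minor => s; rewrite !fctE subr_ge0 x0P osc.
have hi : a * (c + f x0 - u) - a / 4 * c <= c + f x0 - kernel_op (kernel_pow k L) f x.
  rewrite -{2}(opc (c + f x0) x) -opB.
  have -> : c + f x0 - u = \sum_s pi s * ((fun=> c + f x0) - f) s.
    under eq_bigr => s _ do rewrite mulrBr.
    by rewrite sumrB -mulr_suml pi_sum mul1r.
  apply: minor => s; rewrite !fctE; have := x0P s; have := osc s x0; lra.
move: lo hi; set P1 := kernel_op _ _ _; set P2 := kernel_op _ _ _; lra.
Qed.

End TotalVariation.

(** * Mixing of the sampler in a multiple of [n] steps *)

Section Mixing.
Variables (R : realType).

(** A lower bound for the probability of no flip in [n] steps.  Its 8th and 7th
powers account for the [8 n] steps of the mean-square contraction and for the
[7 n] steps of the warm start. *)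
Definition no_flip_const : R := expR (- 2).
Definition msq_rate : R := 1 - (no_flip_const ^+ 8 / 2) ^+ 2 / 10.
Definition warm_mass : R := no_flip_const ^+ 7.

Lemma no_flip_const_gt0 : 0 < no_flip_const.
Proof. exact: expR_gt0. Qed.

Lemma no_flip_const_lt1 : no_flip_const < 1.
Proof. by rewrite /no_flip_const expR_lt1; lra. Qed.

Lemma warm_mass_gt0 : 0 < warm_mass.
Proof. by rewrite exprn_gt0 // no_flip_const_gt0. Qed.

Lemma warm_mass_lt1 : warm_mass < 1.
Proof. by rewrite exprn_ilt1 // ?no_flip_const_lt1 // ltW ?no_flip_const_gt0. Qed.

Lemma no_flip_const8 : 0 < no_flip_const ^+ 8 < 1.
Proof.
by rewrite exprn_gt0 ?no_flip_const_gt0 // exprn_ilt1 // ?no_flip_const_lt1 // ltW ?no_flip_const_gt0.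
Qed.

Lemma msq_rate_bounds : 9 / 10 <= msq_rate /\ msq_rate < 1.
Proof.
have /andP[d0 d1] := no_flip_const8; rewrite /msq_rate.
set d := _ ^+ 8 in d0 d1 *; have : 0 < (d / 2) ^+ 2 by rewrite exprn_gt0 // divr_gt0.
have : (d / 2) ^+ 2 <= 1 by rewrite expr_le1 //; lra.
by split; lra.
Qed.

Variables (n : nat) (p : 'I_n -> R).
Hypothesis n_ge3 : (3 <= n)%N.
Hypothesis p_gt0 : forall i, 0 < p i.
Hypothesis p_sum : \sum_i p i = 1.
Hypothesis p_unimodal : unimodal p.

Notation theta := (n%:R^-1 : R).
Notation P := (dhn_sampler theta p).
Notation K := (dhn_sampler 0 p).
Notation target := (dhn_stationary p).

Let n_gt0 : 0 < n%:R :> R. Proof. by rewrite ltr0n; lia. Qed.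
Let theta_gt0 : 0 < theta. Proof. by rewrite invr_gt0. Qed.
Let theta_le3 : theta <= 3^-1.
Proof. by rewrite lef_pV2 ?posrE // ler_nat. Qed.
Let theta_le1 : theta <= 1. Proof. by apply: le_trans theta_le3 _; lra. Qed.
Let theta_ge0 := ltW theta_gt0.
Let target_ge0 x : 0 <= target x. Proof. by rewrite ltW // target_gt0. Qed.

Lemma no_flip_pow (a t : nat) : (t <= a * n)%N ->
  no_flip_const ^+ a <= (1 - theta) ^+ t.
Proof.
move=> ta; have t01 : 0 <= 1 - theta by rewrite subr_ge0.
apply: (@le_trans _ _ ((1 - theta) ^+ (a * n))).
  rewrite mulnC exprM; apply: lerXn2r; rewrite ?nnegrE ?exprn_ge0 //.
    exact: ltW no_flip_const_gt0.
  by apply: no_flip_prob; lia.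
by apply: ler_wiXn2l => //; rewrite gerBl.
Qed.

(** At even times the chain without flips occupies only the states of the
parity of its start; each of them then receives the whole occupation bound. *)
Lemma even_average_ge x s :
  no_flip_const ^+ 8 / 2 * two_class_kernel target (@parity R n) x s <=
  (4 * n)%:R^-1 * \sum_(r < 4 * n) kernel_pow P r.*2 x s.
Proof.
have [j [up down]] := p_unimodal.
have Pt0 t : 0 <= kernel_pow P t x s.
  exact: (stochastic_pow t (sampler_stochastic p_gt0 theta_ge0 theta_le1)).1.
have avg0 : 0 <= (4 * n)%:R^-1 * \sum_(r < 4 * n) kernel_pow P r.*2 x s.
  by rewrite mulr_ge0 // sumr_ge0.
rewrite /two_class_kernel.
have [e|e] : parity R x * parity R s = 1 \/ parity R x * parity R s = -1.
  by rewrite /parity -exprD -signr_odd; case: (odd _); [right|left].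
- have odd0 t : odd t -> kernel_pow K t x s = 0.
    move=> todd; have := noflip_parity p t x s; rewrite -signr_odd todd expr1.
    move/(congr1 (fun u => u * parity R s)).
    have -> : -1 * (parity R x * kernel_pow K t x s) * parity R s =
      - (parity R x * parity R s * kernel_pow K t x s) by ring.
    rewrite e mul1r -mulrA -expr2 parity_sqr mulr1; lra.
  have even_sum N : occupation K N.*2 x s = \sum_(r < N) kernel_pow K r.*2 x s.
    elim: N => [|N IHN]; first by rewrite /occupation !big_ord0.
    rewrite doubleS /occupation !big_ord_recr /= -/(occupation K N.*2 x s) IHN.
    by rewrite (odd0 N.*2.+1) ?addr0 //= odd_double.
  rewrite e mulrC ler_pdivlMl ?ltr0n; last by lia.
  have occ := occupation_noflip_ge p_gt0 p_sum up down (4 * n) x s.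
  rewrite (_ : 4 * n + 4 * n = (4 * n).*2)%N in occ; last by lia.
  rewrite even_sum in occ.
  apply: (@le_trans _ _ (no_flip_const ^+ 8 * \sum_(r < 4 * n) kernel_pow K r.*2 x s)).
    have -> : (4 * n)%:R * (target s * (1 + 1) * (no_flip_const ^+ 8 / 2)) =
       no_flip_const ^+ 8 * ((4 * n)%:R * target s) by field.
    by rewrite ler_wpM2l // ltW //; case/andP: no_flip_const8.
  rewrite mulr_sumr; apply: ler_sum => r _.
  apply: le_trans (pow_no_flip_le p_gt0 theta_ge0 theta_le1 _ _ _).
  apply: ler_wpM2r; last by apply: no_flip_pow; have := ltn_ord r; lia.
  exact: (stochastic_pow _ (noflip_stochastic p_gt0)).1.
- by rewrite e subrr mulr0 mulr0.
Qed.

Lemma sampler_msq_contract f : \sum_x target x * f x = 0 ->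
  msq target (iter (8 * n) (kernel_op P) f) <= msq_rate * msq target f.
Proof.
move=> f0; have -> : (8 * n = (4 * n).*2)%N by lia.
have /andP[d0 d1] := no_flip_const8.
apply: (@msq_contract _ _ target target_ge0 (dhn_move p) (dhn_sign theta) theta
  (move_reversible p_gt0) (move_stochastic p_gt0) _ _ theta_gt0 _ (@parity R n)
  (target_sum p_sum) (parity_sum p) (no_flip_const ^+ 8 / 2) (4 * n)
  _ _ _ even_average_ge (parity_norm p_sum) (- (1 - 2 * theta))) => //.
- exact: sign_reversible.
- exact: sign_stochastic.
- exact: sign_loss.
- by rewrite divr_gt0.
- lra.
- by rewrite invrK natrM.
- exact: move_parity.
- exact: sign_parity.
have t2 : 0 <= 1 - 2 * theta by have := theta_le3; lra.
have : (1 - 2 * theta) ^+ n <= 3^-1.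
  (* (1 - 2 theta) (1 + 2 theta) <= 1 and n theta = 1 *)
  have b3 : 3 <= (1 + 2 * theta) ^+ n.
    apply: le_trans (bernoulli_ineq _ _); last by have := theta_gt0; lra.
    by rewrite mulrCA divff ?gt_eqF // mulr1; lra.
  rewrite -[leRHS]mul1r ler_pdivlMr //.
  apply: (@le_trans _ _ ((1 - 2 * theta) ^+ n * (1 + 2 * theta) ^+ n)).
    by rewrite ler_wpM2l // exprn_ge0.
  rewrite -exprMn exprn_ile1 //; last by nra.
  by rewrite mulr_ge0 // addr_ge0 // mulr_ge0.
set u := _ ^+ n => u3; have u0 : 0 <= u by rewrite exprn_ge0.
have -> : ((- (1 - 2 * theta)) ^+ (4 * n).*2) ^+ 2 = u ^+ 16.
  by rewrite -mul2n exprM sqrrN -!exprM; congr (_ ^+ _); lia.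
have [r9 _] := msq_rate_bounds; apply: le_trans r9.
apply: (@le_trans _ _ u); last lra.
by rewrite -[leRHS]expr1; apply: ler_wiXn2l => //; lra.
Qed.

Lemma sampler_minorization (k : nat) (c : R) f x :
  18 * msq_rate ^+ k <= (warm_mass / 4) ^+ 2 -> (forall s, 0 <= f s <= c) ->
  warm_mass * (\sum_s target s * f s) - warm_mass / 4 * c
  <= kernel_op (kernel_pow P ((7 + 8 * k) * n)) f x.
Proof.
move=> small f0c; have [j [up down]] := p_unimodal.
have -> : ((7 + 8 * k) * n = 7 * n + 8 * n * k)%N by lia.
(* 7 n = 5 n + 2 n, and return_law_mass halves the 2 n that remain *)
pose v := (7 * n).-1; have vE : (v.+1 = 7 * n)%N by rewrite /v; lia.
have t01 : 0 <= 1 - theta by rewrite subr_ge0.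
pose kappa := (1 - theta) ^+ v * theta.
have kappa0 : 0 <= kappa by rewrite mulr_ge0 // exprn_ge0.
have P_stoch := sampler_stochastic p_gt0 theta_ge0 theta_le1.
have P_stat := sampler_stationary p_gt0 theta_ge0 theta_le1.
have [r9 r1] := msq_rate_bounds.
apply: (@warm_minorization _ _ P target P_stoch target_ge0 (target_sum p_sum)
  (7 * n) (8 * n * k) (fun s => kappa * return_law p j v x s) _ 18 (msq_rate ^+ k)) => //.
- move=> s; rewrite mulr_ge0 ?(return_law_ge0 p_gt0) //= -vE.
  exact: return_law_le_pow.
- move=> s; apply: (@le_trans _ _ (theta * (2 * (v.+1 + 2 * n)%:R * target s))).
    apply: ler_pM => //; first exact: return_law_ge0.
      by rewrite ler_piMl // exprn_ile1 // gerBl.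
    exact: return_law_le.
  rewrite vE -mulnDl natrM le_eqVlt; apply/orP; left; apply/eqP.
  by field; rewrite gt_eqF.
- rewrite -mulr_sumr.
  apply: (@le_trans _ _ (kappa * ((v.+1 - 5 * n)%:R / 2))).
    have -> : (v.+1 - 5 * n)%:R / 2 = n%:R :> R.
      by rewrite vE -mulnBl mulnC natrM; apply: mulfK; rewrite pnatr_eq0.
    rewrite /kappa -mulrA mulVf ?gt_eqF // mulr1.
    by apply: no_flip_pow; exact: leq_pred.
  by rewrite ler_wpM2l // (return_law_mass p_gt0 p_sum up down).
- exact: ltW warm_mass_gt0.
- by rewrite exprn_ge0 //; lra.
move=> g g0; elim: k {small} => [|k IHk]; first by rewrite muln0 expr0 mul1r.
rewrite mulnS iterD exprS -mulrA.
apply: le_trans (sampler_msq_contract _) _; last by rewrite ler_wpM2l //; lra.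
rewrite -kernel_op_pow -[RHS]g0.
under eq_bigr => y _ do rewrite mulr_sumr.
rewrite exchange_big; apply: eq_bigr => s _ /=.
rewrite -(stationary_pow (8 * n * k) P_stat s) mulr_suml.
by apply: eq_bigr => y _; rewrite mulrA.
Qed.

Lemma sampler_tv_dist (k q z : nat) (y : state n) :
  18 * msq_rate ^+ k <= (warm_mass / 4) ^+ 2 ->
  ((7 + 8 * k) * n * q <= z)%N ->
  tv_dist (kernel_pow P z y) target <= (1 - warm_mass / 2) ^+ q.
Proof.
move=> small qz; have P_stoch := sampler_stochastic p_gt0 theta_ge0 theta_le1.
apply: tv_dist_osc => //; [exact: sampler_stationary|exact: target_sum|].
move=> f f01 s; set L := ((7 + 8 * k) * n)%N in qz.
rewrite -(subnKC qz) !kernel_op_pow iterD.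
have g01 x : 0 <= iter (z - L * q) (kernel_op P) f x <= 1.
  rewrite -kernel_op_pow; set Q := kernel_pow _ _.
  have [Q0 Q1] : stochastic Q by exact: stochastic_pow.
  rewrite sumr_ge0 /= => [|w _]; last by rewrite mulr_ge0 //; case/andP: (f01 w).
  rewrite -(Q1 x); apply: ler_sum => w _; rewrite ler_piMr //.
  by case/andP: (f01 w).
move: (iter (z - _) _ f) g01 => g g01.
have : forall x w, iter (L * q) (kernel_op P) g x - iter (L * q) (kernel_op P) g w
    <= (1 - warm_mass / 2) ^+ q.
  elim: q {qz} => [|q IHq] x w.
    rewrite muln0 expr0 /=; have := g01 x; have := g01 w; lra.
  rewrite mulnS iterD exprS -!kernel_op_pow; apply: (osc_contract (pi := target)) => //.
    exact: target_sum.
  by move=> h t h01; apply: sampler_minorization.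
  by move=> t u; rewrite kernel_op_pow; exact: IHq.
by move/(_ y s).
Qed.

End Mixing.

Lemma normalize_gt0 (R : realType) (n : nat) (m : 'I_n -> R) j :
  (forall i, 0 < m i) -> 0 < normalize m j.
Proof.
move=> m0; rewrite divr_gt0 // (bigD1 j) //= ltr_pwDl //.
by apply: sumr_ge0 => i _; exact: ltW.
Qed.

Lemma normalize_sum (R : realType) (n : nat) (m : 'I_n -> R) : (0 < n)%N ->
  (forall i, 0 < m i) -> \sum_j normalize m j = 1.
Proof.
move=> n0 m0; rewrite -mulr_suml divff // gt_eqF //.
rewrite (bigD1 (Ordinal n0)) //= ltr_pwDl //.
by apply: sumr_ge0 => i _; exact: ltW.
Qed.

Lemma normalize_unimodal (R : realType) (n : nat) (m : 'I_n -> R) :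
  (forall i, 0 < m i) -> unimodal m -> unimodal (normalize m).
Proof.
move=> m0 [j [up down]]; exists j.
have s0 : 0 <= (\sum_i m i)^-1 by rewrite invr_ge0 sumr_ge0 // => i _; exact: ltW.
split=> a b h1 h2; rewrite /normalize ler_wpM2r //; [exact: up|exact: down].
Qed.

(** A rate per [A n] steps becomes a rate per [c n] steps, for any [c]: with
[B >= A / c], [B] blocks of length [c n] contain one of length [A n]. *)
Lemma rescale_rate (R : realType) (r c : R) (A : nat) :
  0 < r < 1 -> 0 < c -> (0 < A)%N ->
  exists s C : R, [/\ 0 < s < 1, 0 < C &
    forall c', 0 < c' -> r ^+ Num.truncn (c' / A%:R) <= C * s ^ Num.floor (c' / c)].
Proof.
move=> /andP[r0 r1] c0 A0; have A0' : 0 < A%:R :> R by rewrite ltr0n.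
have [B B1 AB] : exists2 B : nat, (0 < B)%N & A%:R <= B%:R * c.
  exists (Num.bound (A%:R / c)).+1 => //.
  rewrite -ler_pdivrMr //; apply: ltW; apply: (@lt_trans _ _ (Num.bound (A%:R / c))%:R).
    by apply: archi_boundP; rewrite divr_ge0 // ltW.
  by rewrite ltr_nat.
have B0 : 0 < B%:R :> R by rewrite ltr0n.
pose s := 1 - (1 - r) / B%:R.
have k0 : 0 < (1 - r) / B%:R by rewrite divr_gt0 // subr_gt0.
have k1 : (1 - r) / B%:R < 1.
  rewrite ltr_pdivrMr // mul1r; apply: (@lt_le_trans _ _ 1); first lra.
  by rewrite ler1n.
have s01 : 0 < s < 1 by rewrite /s; lra.
have rs : r <= s ^+ B.
  apply: (@le_trans _ _ (1 + B%:R * - ((1 - r) / B%:R))).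
    by rewrite mulrN mulrCA divff ?gt_eqF //; lra.
  by apply: bernoulli_ineq; lra.
case/andP: (s01) => s0 s1.
exists s, (s ^- B); split => //; first by rewrite invr_gt0 exprn_gt0.
move=> c' c'0.
have q0 : 0 <= c' / c by rewrite divr_ge0 // ltW.
have -> : Num.floor (c' / c) = (Num.truncn (c' / c))%:Z.
  by rewrite truncn_floor q0 gez0_abs // floor_ge0.
set q := Num.truncn (c' / c).
have qt : (q %/ B <= Num.truncn (c' / A%:R))%N.
  rewrite truncn_ge_nat; last by rewrite divr_ge0 // ltW.
  rewrite ler_pdivlMr //.
  apply: (@le_trans _ _ ((q %/ B)%:R * (B%:R * c))); first by rewrite ler_wpM2l.
  rewrite mulrA -natrM -ler_pdivlMr //.
  apply: (@le_trans _ _ q%:R); first by rewrite ler_nat leq_divM.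
  by rewrite truncn_le.
rewrite [leRHS]mulrC ler_pdivlMr ?exprn_gt0 // -exprnP.
apply: (@le_trans _ _ (s ^+ (B * (q %/ B)) * s ^+ B)).
  rewrite ler_wpM2r ?exprn_ge0 ?(ltW s0) //.
  apply: (@le_trans _ _ (r ^+ (q %/ B))).
    by apply: ler_wiXn2l => //; exact: ltW.
  by rewrite exprM lerXn2r // ?nnegrE ?exprn_ge0 // ltW.
rewrite -exprD; apply: ler_wiXn2l => //; [exact: ltW|exact: ltW|].
by rewrite -mulnSr mulnC ltnW // ltn_ceil.
Qed.

Theorem theorem4 (R : realType) (m : forall n : nat, 'I_n -> R)
    (m_gt0 : forall n : nat, odd n -> (3 <= n)%N -> forall j : 'I_n, 0 < m n j)
    (m_unimodal : forall n : nat, odd n -> (3 <= n)%N -> unimodal (m n))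
    (c : R) (c_gt0 : 0 < c) :
  exists chat C : R, 0 < chat /\ 0 < C /\
    forall (c' : R) (z : nat -> nat) (y : forall k : nat, state (odd_ge3 k)),
      0 < c' ->
      (forall n : nat, odd n -> (3 <= n)%N -> c' * n%:R <= (z n)%:R) ->
      (limn_esup (fun k : nat =>
         let n := odd_ge3 k in
         let p := normalize (m n) in
         (tv_dist (kernel_pow (dhn_sampler n%:R^-1 p) (z n) (y k))
                  (dhn_stationary p))%:E)
       <= (C * (1 - chat / expR c) ^ Num.floor (c' / c))%:E)%E.
Proof.
have w0 := warm_mass_gt0 R; have w1 := warm_mass_lt1 R.
have [r9 r1] := msq_rate_bounds R.
have [k small] : exists k, msq_rate R ^+ k <= (warm_mass R / 4) ^+ 2 / 18.
  by apply: exists_exp_le => //; [lra|rewrite divr_gt0 // exprn_gt0 // divr_gt0].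
rewrite ler_pdivlMr // mulrC in small.
pose A := (7 + 8 * k)%N.
have [s [C [/andP[s0 s1] C0 rate]]] := @rescale_rate R (1 - warm_mass R / 2) c A
  ltac:(lra) c_gt0 isT.
exists ((1 - s) * expR c), C; split; first by rewrite mulr_gt0 ?expR_gt0 ?subr_gt0.
split=> // c' z y c'0 zc'.
rewrite mulfK ?gt_eqF ?expR_gt0 // opprB addrC subrK.
set u := fun k : nat => _.
have bound i : (u i <= (C * s ^ Num.floor (c' / c))%:E)%E.
  rewrite lee_fin; apply: le_trans (rate _ c'0).
  have n_odd : odd (odd_ge3 i) by rewrite /odd_ge3 /= odd_double.
  have n3 : (3 <= odd_ge3 i)%N by [].
  have mi0 := m_gt0 _ n_odd n3.
  apply: sampler_tv_dist small _ => //.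
  - by move=> j; exact: normalize_gt0.
  - exact: normalize_sum.
  - exact: normalize_unimodal (m_unimodal _ n_odd n3).
  rewrite -(ler_nat R); apply: le_trans (zc' _ n_odd n3).
  rewrite -/A mulnAC mulnC natrM mulrC ler_wpM2r // natrM mulrC -ler_pdivlMr ?ltr0n //.
  by rewrite truncn_le // divr_ge0 // ltW.
apply: (@le_trans _ _ (ereal_sup (range u))).
  by apply: ereal_inf_lbound; exists setT => //; exact: filterT.
by apply: ge_ereal_sup => _ [i _ <-].
Qed.
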